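(* Let $g\geq2$, $n\geq0$, and let $d$ be a square-free integer. Then there exists a normal finite-degree cover $\widetilde{\Sigma}\rightarrow\Sigma_{g,n}$ with $\mathrm{H}_1^{d\text{-prim}}(\widetilde{\Sigma};\mathbb{Q})\neq\mathrm{H}_1(\widetilde{\Sigma};\mathbb{Q})$. Furthermore, we may require the degree of this cover to divide some power of $d$.
   Context: $\Sigma_{g,n}$ denotes the connected orientable surface of genus $g$ with $n$ punctures. Covers are (unbranched) connected covering spaces. Given a finite-degree cover $\widetilde{\Sigma} \to \Sigma_{g,n}$, an elevation of a loop $\gamma$ on $\Sigma_{g,n}$ is a minimal concatenation of lifts of $\gamma$ which forms a closed curve in $\widetilde{\Sigma}$. Let $\mathcal{O}_d$ be the set of all loops on $\Sigma_{g,n}$ which map to nonzero vectors in $\mathrm{H}_1(\Sigma_{g,n};\mathbb{Z}/d)$. The $d$-primitive homology $\mathrm{H}_1^{d\text{-prim}}(\widetilde{\Sigma};\mathbb{Q})$ is the subspace of $\mathrm{H}_1(\widetilde{\Sigma};\mathbb{Q})$ spanned by the classes of all elevations of loops in $\mathcal{O}_d$. Algebraically, if $R\leq\pi_1\Sigma_{g,n}$ is the subgroup corresponding to $\widetilde\Sigma$, it is the span in $\mathrm{H}_1(R;\mathbb{Q})$ of all $[x^m]$ with $x\in\pi_1\Sigma_{g,n}$ representing a loop in $\mathcal{O}_d$, $m\in\mathbb{Z}$, $x^m\in R$. *)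

(* Defs.v *)
(* The homology of surfaces and of their covers is expressed through fundamental
   groups: by Hurewicz, H_1 of a connected cover is H_1 of the corresponding
   subgroup, and a cover is normal of degree N exactly when that subgroup is
   normal of index N. *)
From HB Require Import structures.
From mathcomp Require Import all_boot all_order all_algebra finmap.
From mathcomp.multinomials Require Import monalg.
From mathcomp Require Import boolp classical_sets functions cardinality.

Set Implicit Arguments.
Unset Strict Implicit.
Unset Printing Implicit Defensive.

Import GRing.Theory.

Local Open Scope classical_set_scope.
Local Open Scope quotient_scope.
Local Open Scope ring_scope.

Section Presentation.
Variables (X : choiceType) (rels : seq (seq (X * bool))).

(* The letter (x, false) stands for the generator x, and (x, true) for its
   formal inverse. *)
Definition word := seq (X * bool).

Definition inv_letter (l : X * bool) : X * bool := (l.1, ~~ l.2).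
Definition inv_word (w : word) : word := rev (map inv_letter w).

Inductive word_equiv : word -> word -> Prop :=
| WordRefl w : word_equiv w w
| WordSym v w : word_equiv v w -> word_equiv w v
| WordTrans u v w : word_equiv u v -> word_equiv v w -> word_equiv u w
| WordCancel u v l : word_equiv (u ++ l :: inv_letter l :: v) (u ++ v)
| WordRel u v r : r \in rels -> word_equiv (u ++ r ++ v) (u ++ v).

Definition word_equivb (v w : word) : bool := `[< word_equiv v w >].

Lemma word_equivb_class : equiv_class_of word_equivb.
Proof.
split=> [w|v w|v u w].
- exact/asboolP/WordRefl.
- by apply/asboolP/asboolP; exact: WordSym.
- by move=> /asboolP h1 /asboolP h2; apply/asboolP/(WordTrans h1 h2).
Qed.

Canonical word_equivb_equiv := EquivRelPack word_equivb_class.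
Canonical word_equivb_encModRel := defaultEncModRel word_equivb.

Definition presented_group := {eq_quot word_equivb}.
HB.instance Definition _ : EqQuotient word word_equivb presented_group :=
  EqQuotient.on presented_group.
HB.instance Definition _ := Choice.on presented_group.

Lemma presentedP (v w : word) :
  reflect (word_equiv v w) (v == w %[mod presented_group]).
Proof. by rewrite piE; exact: asboolP. Qed.

Lemma word_equiv_cat u v u' v' :
  word_equiv u u' -> word_equiv v v' -> word_equiv (u ++ v) (u' ++ v').
Proof.
move=> hu hv; apply: (@WordTrans _ (u' ++ v)).
- elim: hu => {u u' hv} [*|*|? w ? *|u w l|u w r hr].
  + exact: WordRefl.
  + exact: WordSym.
  + by apply: (@WordTrans _ (w ++ v)).
  + by rewrite -!catA /=; exact: WordCancel.
  + by rewrite -!catA; exact: WordRel.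
- elim: hv => {u v v' hu} [*|*|? w ? *|u w l|u w r hr].
  + exact: WordRefl.
  + exact: WordSym.
  + by apply: (@WordTrans _ (u' ++ w)).
  + by rewrite !catA; exact: WordCancel.
  + by rewrite !(catA u'); exact: WordRel.
Qed.

Lemma inv_letterK : involutive inv_letter.
Proof. by case=> x b; rewrite /inv_letter negbK. Qed.

Lemma inv_wordK : involutive inv_word.
Proof. by move=> w; rewrite /inv_word map_rev revK (mapK inv_letterK). Qed.

Lemma word_equiv_mulV w : word_equiv (w ++ inv_word w) [::].
Proof.
elim: w => [|l w IH]; first exact: WordRefl.
apply: (@WordTrans _ [:: l; inv_letter l]); last exact: (WordCancel [::] [::] l).
rewrite /inv_word map_cons rev_cons -cats1 /= catA -!cat_cons -(cat1s l).
exact: (word_equiv_cat (WordRefl [:: l])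
          (word_equiv_cat IH (WordRefl [:: inv_letter l]))).
Qed.

Lemma word_equiv_inv v w : word_equiv v w -> word_equiv (inv_word v) (inv_word w).
Proof.
move=> h.
have hV u : word_equiv (inv_word u ++ u) [::].
  by rewrite -{2}[u]inv_wordK; exact: word_equiv_mulV.
apply: (@WordTrans _ (inv_word v ++ w ++ inv_word w)).
  rewrite -{1}[inv_word v]cats0; apply: word_equiv_cat; first exact: WordRefl.
  exact/WordSym/word_equiv_mulV.
rewrite catA -[X in word_equiv _ X]cat0s.
apply: word_equiv_cat; last exact: WordRefl.
apply: WordTrans (hV v); apply: word_equiv_cat; first exact: WordRefl.
exact: WordSym.
Qed.

Local Notation PG := presented_group.

Lemma presentedW (P : PG -> Prop) : (forall w, P (\pi_PG w)) -> forall x, P x.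
Proof. by move=> h x; rewrite -[x]reprK. Qed.

Definition presented_one : PG := \pi_PG [::].
Definition presented_mul (x y : PG) : PG := \pi_PG (repr x ++ repr y : word).
Definition presented_inv (x : PG) : PG := \pi_PG (inv_word (repr x)).

Lemma word_equiv_repr (w : word) : word_equiv (repr (\pi_PG w)) w.
Proof. by apply/presentedP; rewrite reprK. Qed.

Lemma pi_mulP (v w : word) :
  presented_mul (\pi_PG v) (\pi_PG w) = \pi_PG (v ++ w : word).
Proof. by apply/eqP/presentedP/word_equiv_cat; exact: word_equiv_repr. Qed.

Lemma pi_invP (w : word) : presented_inv (\pi_PG w) = \pi_PG (inv_word w).
Proof. by apply/eqP/presentedP/word_equiv_inv; exact: word_equiv_repr. Qed.

Fact presented_mulA : associative presented_mul.
Proof.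
move=> x y z; elim/presentedW: x => u; elim/presentedW: y => v.
by elim/presentedW: z => w; rewrite !pi_mulP catA.
Qed.

Fact presented_mul1 : left_id presented_one presented_mul.
Proof. by move=> x; elim/presentedW: x => w; rewrite pi_mulP. Qed.

Fact presented_1mul : right_id presented_one presented_mul.
Proof. by move=> x; elim/presentedW: x => w; rewrite pi_mulP cats0. Qed.

Fact presented_mulV : right_inverse presented_one presented_inv presented_mul.
Proof.
move=> x; elim/presentedW: x => w; rewrite pi_invP pi_mulP.
exact/eqP/presentedP/word_equiv_mulV.
Qed.

Fact presented_Vmul : left_inverse presented_one presented_inv presented_mul.
Proof.
move=> x; elim/presentedW: x => w.
rewrite pi_invP pi_mulP -{2}[w]inv_wordK.
exact/eqP/presentedP/word_equiv_mulV.
Qed.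

HB.instance Definition _ := isGroup.Build presented_group
  presented_mulA presented_mul1 presented_1mul presented_Vmul presented_mulV.

Definition word_class (w : word) : PG := \pi_PG w.

Lemma word_classM v w : word_class (v ++ w) = (word_class v * word_class w)%g.
Proof. exact: esym (pi_mulP v w). Qed.

Lemma word_classV w : word_class (inv_word w) = (word_class w)^-1%g.
Proof. exact: esym (pi_invP w). Qed.

Lemma word_class_rel r : r \in rels -> word_class r = 1%g.
Proof.
move=> hr; apply/eqP/presentedP.
by have := WordRel [::] [::] hr; rewrite cats0.
Qed.

End Presentation.

(* Generators: inl (i, false) = a_i and inl (i, true) = b_i are the standard
   handle curves, inr j = c_j is a loop around the j-th puncture. *)
Definition surface_gen (g n : nat) : choiceType := ('I_g * bool + 'I_n)%type.

(* [a_1, b_1] ... [a_g, b_g] c_1 ... c_n *)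
Definition surface_relator (g n : nat) : word (surface_gen g n) :=
  flatten [seq [:: (inl (i, false), false); (inl (i, true), false);
                   (inl (i, false), true); (inl (i, true), true)]
          | i <- enum 'I_g]
  ++ [seq (inr j, false) | j <- enum 'I_n].

(* The fundamental group of the surface of genus g with n punctures; it is free
   when n > 0. *)
Definition surface_group (g n : nat) : groupType :=
  presented_group [:: surface_relator g n].

Section GroupHomology.
Variables (G : groupType) (A : zmodType).

(* Low degrees of the bar complex with trivial coefficients A: 1-chains are
   finite formal sums of a[x], the differential C_1 -> C_0 is zero, and the
   differential C_2 -> C_1 sends a[x|y] to a[y] - a[xy] + a[x]. Hence
   H_1(G; A) is C_1 modulo the image of C_2. *)
Definition chain1 := {malg A[G]}.

Definition bar_d2 (s : A * G * G) : chain1 :=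
  let: (a, x, y) := s in << a *g y >> - << a *g (x * y)%g >> + << a *g x >>.

Definition boundary1 : {pred chain1} :=
  fun c => `[< exists s : seq (A * G * G), c = \sum_(t <- s) bar_d2 t >].

Fact boundary1_zmod_closed : zmod_closed boundary1.
Proof.
split=> [|_ _ /asboolP[s ->] /asboolP[t ->]]; apply/asboolP.
  by exists [::]; rewrite big_nil.
exists (s ++ [seq (- u.1.1, u.1.2, u.2) | u <- t]).
rewrite big_cat big_map /=; congr (_ + _).
rewrite -sumrN; apply: eq_bigr => -[[a x] y] _ /=.
by rewrite !raddfN /= !opprD !opprK.
Qed.
HB.instance Definition _ :=
  GRing.isZmodClosed.Build chain1 boundary1 boundary1_zmod_closed.

Definition H1 := {ideal_quot boundary1}.
HB.instance Definition _ : EqQuotient chain1 (Quotient.equiv boundary1) H1 :=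
  EqQuotient.on H1.
HB.instance Definition _ := GRing.Zmodule.on H1.

Definition H1_class (a : A) (x : G) : H1 := \pi_H1 (<< a *g x >> : chain1).

End GroupHomology.

Section H1Scaling.
Variables (G : groupType) (K : nzRingType).
Local Notation C1 := (chain1 G K).
Local Notation H := (H1 G K).

Fact pi_H1D (c e : C1) : \pi_H (c + e) = \pi_H c + \pi_H e.
Proof. by rewrite !piE. Qed.

Fact boundary1Z (k : K) (c : C1) :
  c \in @boundary1 G K -> (k *: c : C1) \in @boundary1 G K.
Proof.
move=> /asboolP[s ->]; apply/asboolP.
exists [seq (k * u.1.1, u.1.2, u.2) | u <- s].
rewrite big_map scaler_sumr; apply: eq_bigr => -[[a x] y] _ /=.
have Z z : k *: << a *g z >> = << k * a *g z >> :> C1.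
  by apply/malgP => w; rewrite mcoeffZ !mcoeffU mulrnAr.
by rewrite scalerDr scalerBr !Z.
Qed.

Definition H1_scale (k : K) (h : H) : H := \pi_H (k *: (repr h : C1)).

Fact H1_scale_pi k (c : C1) : H1_scale k (\pi_H c) = \pi_H (k *: c).
Proof.
apply/eqP; rewrite /H1_scale -Quotient.idealrBE -scalerBr; apply: boundary1Z.
by rewrite Quotient.idealrBE reprK.
Qed.

Lemma H1W (P : H -> Prop) : (forall c, P (\pi_H c)) -> forall h, P h.
Proof. by move=> hP h; rewrite -[h]reprK. Qed.

Fact H1_scaleA a b h : H1_scale a (H1_scale b h) = H1_scale (a * b) h.
Proof. by elim/H1W: h => c; rewrite !H1_scale_pi scalerA. Qed.

Fact H1_scale1 : left_id 1 H1_scale.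
Proof. by move=> h; elim/H1W: h => c; rewrite H1_scale_pi scale1r. Qed.

Fact H1_scaleDr : right_distributive H1_scale +%R.
Proof.
move=> k h h'; elim/H1W: h => c; elim/H1W: h' => e.
by rewrite -pi_H1D 3!H1_scale_pi scalerDr; exact: pi_H1D.
Qed.

Fact H1_scaleDl h : {morph H1_scale^~ h : a b / a + b}.
Proof.
elim/H1W: h => c a b.
by rewrite /= 3!H1_scale_pi scalerDl; exact: pi_H1D.
Qed.

HB.instance Definition _ := GRing.Zmodule_isLmodule.Build K H
  H1_scaleA H1_scale1 H1_scaleDr H1_scaleDl.

End H1Scaling.

Definition lin_span (K : nzRingType) (V : lmodType K) (S : set V) : set V :=
  [set v | exists2 s : seq (K * V),
     {in s, forall p, S p.2} & v = \sum_(p <- s) p.1 *: p.2].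

Section Subgroups.
Variables (G : groupType) (R : groupClosed G).

Definition subgroup := {x : G | x \in R}.
HB.instance Definition _ := SubChoice.on subgroup.

Fact subgroup_closed : group_closed R.
Proof. by split=> [|x y hx hy]; [exact: gpred1 | exact: gpredF]. Qed.
HB.instance Definition _ :=
  SubChoice_isSubGroup.Build G (mem R) subgroup subgroup_closed.

Definition normal_subgroup := forall x y : G, x \in R -> (x ^ y)%g \in R.

Definition left_coset (x : G) : set G := [set (x * r)%g | r in [set` R]].

Definition has_index (N : nat) := (range left_coset #= `I_N)%card.

End Subgroups.

Definition expgz (G : groupType) (x : G) (m : int) : G :=
  match m with Posz k => (x ^+ k)%g | Negz k => (x ^- k.+1)%g end.

Definition Zmod (d : int) : zmodType :=
  {ideal_quot (GRing.ZmodClosed.clone int (dvdz d) _)}.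

(* The set O_d: loops with nonzero class in H_1(-; Z/d). The coefficient 1 is
   the residue class of 1 : int; for d = 1 or -1 it vanishes. *)
Definition nonzero_mod_loops (G : groupType) (d : int) : set G :=
  [set x | H1_class (\pi_(Zmod d) 1 : Zmod d) x != 0].

(* An elevation of the loop x corresponds to a conjugate of a minimal power of
   x lying in R; allowing every power and every x in O_d, which is closed under
   conjugation, gives the same span. *)
Definition prim_homology (G : groupType) (d : int) (R : groupClosed G) :
    set (H1 (subgroup R) rat) :=
  lin_span [set H1_class (1 : rat) y | y in
    [set y : subgroup R | exists2 x : G, nonzero_mod_loops d x &
                          exists m : int, val y = expgz x m]].
Arguments prim_homology {G} d R _.

Definition squarefree (d : int) :=
  forall m : int, (m * m %| d)%Z -> m \is a GRing.unit.

(* Main.v *)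
(* Suppose phi maps the surface group onto a finite group with a central element
   z0 in such a way that, for a fixed M, phi(x)^M is a power of z0 for every x and
   is nontrivial for x in O_d. Let zeta be a root of unity of the same order as
   z0, and let V be the functions u on the finite group with
   u(z0 y) = zeta u(y). No x in O_d fixes a nonzero vector of V. The presentation
   has at least 4 generators and 1 relator, so the crossed homomorphisms into V
   form a space of dimension > dim V, and some crossed homomorphism F is not
   principal. By averaging, F does not vanish on R = ker phi, where it is
   additive, whereas F(x^m) is fixed by x and hence vanishes for x in O_d. Thus
   F|_R separates H_1(R) from its d-primitive part.

   Direct products reduce the construction of phi to d = p prime. Let L be the
   field with p^N elements, N a large power of p. The matrices 1 + a t + ... in
   L{t}/(t^(N+1)), where t a = a^p t, are unitriangular and satisfy
   (1 + a t + ...)^N = 1 + Norm(a) t^N with Norm(a) in F_p. So it suffices to map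
   the generators to unitriangular matrices such that the values of a are as
   independent over F_p as the homology classes of the generators. For punctured
   surfaces the group is free. For closed surfaces the relation first forces
   sum (a_i b_i^p - b_i a_i^p) = 0, which an explicit choice satisfies; the other
   entries are then found one row at a time, because multiplying the image of a_1
   by a transvection changes the relator in the required way. *)
From HB Require Import structures.
Require Import Defs.
From mathcomp Require Import all_boot all_order all_algebra all_fingroup.
From mathcomp Require Import all_solvable all_field.
From mathcomp Require Import zify ring.
From mathcomp.multinomials Require Import monalg.
From mathcomp Require Import generic_quotient boolp classical_sets.
From mathcomp Require Import functions cardinality.

Set Implicit Arguments.
Unset Strict Implicit.
Unset Printing Implicit Defensive.

Import GRing.Theory.

Local Open Scope classical_set_scope.
Local Open Scope quotient_scope.
Local Open Scope ring_scope.

(** * Homomorphisms out of a presented group *)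

(** Letters act on an arbitrary type, so that one invariance result serves both evaluation in a
    group and the affine action behind crossed homomorphisms. *)
Lemma foldr_word_equiv (X : choiceType) (rels : seq (seq (X * bool)))
    (T : Type) (a : X * bool -> T -> T) :
  (forall l t, a l (a (inv_letter l) t) = t) ->
  (forall r, r \in rels -> forall t, foldr a t r = t) ->
  forall v w, word_equiv rels v w -> forall t, foldr a t v = foldr a t w.
Proof.
move=> aK arel v w; elim=> {v w} [//|v w _ IH t|u v w _ IH1 _ IH2 t|u v l t|u v r].
- by rewrite IH.
- by rewrite IH1.
- by rewrite !foldr_cat /= aK.
- by move=> hr t; rewrite !foldr_cat (arel r).
Qed.

Lemma word_class_surj (X : choiceType) (rels : seq (seq (X * bool)))
    (x : presented_group rels) : exists w, x = word_class rels w.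
Proof. by exists (repr x); rewrite /word_class reprK. Qed.

Lemma word_class_cancel (X : choiceType) (rels : seq (seq (X * bool))) l :
  word_class rels [:: l; inv_letter l] = 1%g.
Proof. exact/eqP/presentedP/(WordCancel rels [::] [::] l). Qed.

Section Evaluation.
Variables (X : choiceType) (gT : groupType) (f : X -> gT).

Definition letter_val (l : X * bool) : gT :=
  if l.2 then (f l.1)^-1%g else f l.1.

Definition word_val (w : word X) : gT :=
  foldr (fun l t => (letter_val l * t)%g) 1%g w.

Lemma word_val_foldr w t :
  foldr (fun l t => (letter_val l * t)%g) t w = (word_val w * t)%g.
Proof. by elim: w => [|l w IH] /=; rewrite ?mul1g // IH mulgA. Qed.

Lemma word_val_cat v w : word_val (v ++ w) = (word_val v * word_val w)%g.
Proof. by rewrite {1}/word_val foldr_cat word_val_foldr. Qed.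

Lemma presented_hom (rels : seq (seq (X * bool))) :
  (forall r, r \in rels -> word_val r = 1%g) ->
  exists2 phi : presented_group rels -> gT,
    {morph phi : x y / (x * y)%g} & forall w, phi (word_class rels w) = word_val w.
Proof.
move=> frel.
have ext v w : word_equiv rels v w -> word_val v = word_val w.
  move=> /(@foldr_word_equiv _ _ _ (fun l t => letter_val l * t)%g) ext.
  apply: ext => [[x b] t|r hr t].
    by rewrite /letter_val /= mulgA; case: b; rewrite /= ?mulgV ?mulVg mul1g.
  by rewrite word_val_foldr frel // mul1g.
have phiE w : word_val (repr (word_class rels w)) = word_val w.
  exact/ext/word_equiv_repr.
exists (fun x => word_val (repr x)) => // x y.
have [v ->] := word_class_surj x; have [w ->] := word_class_surj y.
by rewrite -word_classM !phiE word_val_cat.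
Qed.

End Evaluation.

(** * Crossed homomorphisms by Fox calculus *)

Section CrossedHoms.
Variables (X : finType) (r : seq (X * bool)).
Local Notation G := (presented_group [:: r]).
Local Notation "[ w ]" := (word_class [:: r] w).
Variables (K : fieldType) (V : vectType K) (act : G -> 'End(V)).
Hypothesis act1 : act 1%g = \1%VF.
Hypothesis actM : forall x y, act (x * y)%g = (act x \o act y)%VF.

(** The value on an inverse letter is forced by the cocycle rule: F(x^-1) = - x^-1 F(x). *)
Definition letter_diff (s : X -> V) (l : X * bool) : V :=
  if l.2 then - act [ [:: l] ] (s l.1) else s l.1.

(** The affine map sending [t] to F(w) + w t; carrying [t] along turns concatenation of words into
    composition. *)
Definition word_diff (s : X -> V) (t : V) (w : word X) : V :=
  foldr (fun l t => letter_diff s l + act [ [:: l] ] t) t w.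

Lemma word_diffE s t w : word_diff s t w = word_diff s 0 w + act [w] t.
Proof.
elim: w => [|l w IH] /=.
  by rewrite (_ : [ [::] ] = 1%g) // act1 add0r id_lfunE.
rewrite IH (_ : [l :: w] = [ [:: l] ] * [w])%g; last by rewrite -word_classM.
by rewrite actM comp_lfunE linearD addrA.
Qed.

(** A crossed homomorphism is an affine action with linear part [act]. The relator has trivial
    linear part, so it acts trivially as soon as its translation part [word_diff s 0 r] vanishes. *)
Lemma crossed_hom_lift (s : X -> V) : word_diff s 0 r = 0 ->
  exists2 F : G -> V, forall x y, F (x * y)%g = F x + act x (F y) &
    forall x, F [ [:: (x, false)] ] = s x.
Proof.
move=> s0.
have ext v w t : word_equiv [:: r] v w -> word_diff s t v = word_diff s t w.
  move=> /(@foldr_word_equiv _ _ _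
    (fun l t => letter_diff s l + act [ [:: l] ] t)) ext.
  apply: ext => [l u|_ /[!inE] /eqP-> u].
    rewrite linearD /= addrA -comp_lfunE -actM -word_classM.
    rewrite (word_class_cancel [:: r] l : [ [:: l] ++ [:: _] ] = 1%g).
    rewrite act1 id_lfunE -[RHS]add0r; congr (_ + _).
    case: l => x [] /=; rewrite /letter_diff /= ?addNr //.
    rewrite linearN /= -comp_lfunE -actM -word_classM.
    rewrite (word_class_cancel [:: r] (x, false)
      : [ [:: _] ++ [:: (x, true)] ] = 1%g).
    by rewrite act1 id_lfunE subrr.
  rewrite [LHS]word_diffE s0 add0r.
  by rewrite (word_class_rel (mem_head _ _)) act1 id_lfunE.
have FE w : word_diff s 0 (repr [w]) = word_diff s 0 w.
  exact/ext/word_equiv_repr.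
exists (fun x => word_diff s 0 (repr x)) => [x y|x]; last first.
  by rewrite FE /= linear0 addr0.
have [v ->] := word_class_surj x; have [w ->] := word_class_surj y.
rewrite -word_classM !FE -[LHS]/(foldr _ _ _) foldr_cat.
exact: word_diffE.
Qed.

Hypotheses (V_gt0 : (0 < \dim (fullv : {vspace V}))%N) (X_gt2 : (2 < #|X|)%N).

(* There are #|X| * dim V candidate crossed homomorphisms and dim V conditions
   from the relator, but at most dim V principal ones. *)
Lemma nonprincipal_crossed_hom :
  exists2 F : G -> V, forall x y, F (x * y)%g = F x + act x (F y) &
    forall v, exists x, F x <> act x v - v.
Proof.
pose Phi (s : {ffun X -> V}) := word_diff s 0 r.
have Phi_lin : linear Phi.
  move=> a s t; rewrite /Phi; elim: (r) => [|l w IH] /=.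
    by rewrite scaler0 addr0.
  rewrite IH linearP /= scalerDr addrACA; congr (_ + _).
  rewrite /letter_diff !ffunE; case: l.2 => //.
  by rewrite linearP /= scalerN opprD.
pose Psi (v : V) := [ffun x => act [ [:: (x, false)] ] v - v].
have Psi_lin : linear Psi.
  move=> a u v; apply/ffunP=> x; rewrite !ffunE linearP /=.
  by rewrite scalerBr opprD addrACA.
pose f := linfun (HB.pack Phi (GRing.isLinear.Build _ _ _ _ Phi Phi_lin)
  : {linear _ -> _}).
pose h := linfun (HB.pack Psi (GRing.isLinear.Build _ _ _ _ Psi Psi_lin)
  : {linear _ -> _}).
have fE s : f s = Phi s by rewrite lfunE.
have hE v : h v = Psi v by rewrite lfunE.
apply: contrapT => noF.
suff /dimvS sub : (lker f <= limg h)%VS.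
  have := limg_ker_dim f fullv; rewrite capfv.
  have := limg_ker_dim h fullv; rewrite capfv.
  have := dimvS (subvf (limg f)).
  have := V_gt0; move: sub; rewrite !dimvf.
  rewrite (_ : dim {ffun X -> V} = (#|X| * dim V)%N) //.
  have := X_gt2; move: #|X| (dim V) (\dim _) (\dim (limg h)) (\dim _).
  clear; nia.
apply/subvP => s; rewrite memv_ker fE => /eqP /crossed_hom_lift[F FM Fs].
have [v Fv] : exists v, forall x, F x = act x v - v.
  apply: contrapT => nov; apply: noF; exists F => // v.
  by apply: contrapT => nox; apply: nov; exists v => x;
    apply: contrapT => nx; apply: nox; exists x.
suff -> : s = h v by apply/memv_img/memvf.
by rewrite hE; apply/ffunP => x; rewrite ffunE -Fv Fs.
Qed.

End CrossedHoms.

(** * The representation induced from a central character *)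

Section Eigenmodule.
Variables (gT : finGroupType) (z0 : gT).
Local Notation W := {ffun gT -> algC^o}.

Definition ffun_rtrans (h : gT) (u : W) : W := [ffun y => u (y * h)%g].
Definition ffun_ltrans (h : gT) (u : W) : W := [ffun y => u (h * y)%g].

Fact ffun_rtrans_linear h : linear (ffun_rtrans h).
Proof. by move=> a u v; apply/ffunP=> y; rewrite !ffunE. Qed.
HB.instance Definition _ h :=
  GRing.isLinear.Build _ _ _ _ (ffun_rtrans h) (ffun_rtrans_linear h).

Fact ffun_ltrans_linear h : linear (ffun_ltrans h).
Proof. by move=> a u v; apply/ffunP=> y; rewrite !ffunE. Qed.
HB.instance Definition _ h :=
  GRing.isLinear.Build _ _ _ _ (ffun_ltrans h) (ffun_ltrans_linear h).

(** For [zeta] of the same order as [z0], this is the representation induced from the character of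
    the cyclic group of [z0] with value [zeta] at [z0]; right translations are the action. *)
Definition central_eigenspace (zeta : algC) : {vspace W} :=
  lker (linfun (ffun_ltrans z0) - zeta *: \1)%VF.

Lemma central_eigenspaceP zeta (u : W) :
  reflect (forall y, u (z0 * y)%g = zeta * u y) (u \in central_eigenspace zeta).
Proof.
rewrite memv_ker !lfunE /= opp_lfunE scale_lfunE id_lfunE lfunE subr_eq0 /=.
apply: (iffP eqP) => [/ffunP eq_u y|eq_u].
  by have := eq_u y; rewrite !ffunE.
by apply/ffunP => y; rewrite !ffunE.
Qed.

Lemma central_eigenspaceX zeta (u : W) i y : u \in central_eigenspace zeta ->
  u (z0 ^+ i * y)%g = zeta ^+ i * u y.
Proof.
move/central_eigenspaceP => eq_u; elim: i => [|i IH].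
  by rewrite mul1g mul1r.
by rewrite expgS -mulgA eq_u IH exprS mulrA.
Qed.

Lemma rtrans_eigenspace zeta h u : u \in central_eigenspace zeta ->
  ffun_rtrans h u \in central_eigenspace zeta.
Proof.
move/central_eigenspaceP => eq_u; apply/central_eigenspaceP => y.
by rewrite !ffunE -mulgA eq_u.
Qed.

Lemma central_eigenspace_dim zeta : #[z0]%g.-primitive_root zeta ->
  (0 < \dim (central_eigenspace zeta))%N.
Proof.
move=> pz; have z_n := prim_expr_order pz.
(* The function supported on the powers of [z0], with value [zeta ^+ i] at [z0 ^+ i]. *)
pose u : W := [ffun y => \sum_(i < #[z0]%g) (y == z0 ^+ i)%g%:R * zeta ^+ i].
have : u \in central_eigenspace zeta.
  apply/central_eigenspaceP => y; rewrite !ffunE mulr_sumr.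
  pose F (i : nat) := (z0 * y == z0 ^+ i)%g%:R * zeta ^+ i.
  have n_gt0 := order_gt0 z0.
  rewrite -[LHS]/(\sum_(i < #[z0]%g) F i) -(big_mkord xpredT F).
  (* A cyclic shift of the index: [F] agrees at 0 and at the order, since [z0] and [zeta] have the
     same order. *)
  transitivity (\sum_(0 <= i < #[z0]%g) F i.+1).
    case: #[z0]%g n_gt0 z_n (expg_order z0) @F => // n _ z_n e_n F.
    rewrite big_nat_recl // big_nat_recr //= addrC; congr (_ + _).
    by rewrite /F z_n e_n expr0 expg0.
  rewrite big_mkord; apply: eq_bigr => i _.
  by rewrite /F expgS (inj_eq (mulgI _)) exprS mulrCA.
have u1 : u 1%g != 0.
  rewrite ffunE (bigD1 (Ordinal (order_gt0 z0))) //= eqxx mulr1 big1 ?addr0.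
    by rewrite oner_eq0.
  move=> i; rewrite -val_eqE /= => i0; case: eqP => [e|]; last by rewrite mul0r.
  have /eqP := esym e; rewrite -order_dvdn => /dvdn_leq.
  by rewrite lt0n leqNgt ltn_ord => /(_ i0).
move=> uE; rewrite lt0n dimv_eq0; apply: contra u1 => /eqP E0.
by move: uE; rewrite E0 memv0 => /eqP->; rewrite ffunE.
Qed.

End Eigenmodule.

(** * A functional on the kernel of a finite quotient *)

Section KernelFunctional.
Variables (X : finType) (r : seq (X * bool)).
Local Notation G := (presented_group [:: r]).
Variables (gT : finGroupType) (phi : G -> gT) (z0 : gT).
Hypothesis X_gt2 : (2 < #|X|)%N.
Hypothesis phiM : {morph phi : x y / (x * y)%g}.
Hypothesis z0_central : forall y, commute z0 y.

(** [f] is a coordinate of a non-principal crossed homomorphism [F]. If [x] commutes with [w] in the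
    kernel, expanding F(x w) = F(w x) shows that [x] fixes F(w); but a power of [x] acts as a scalar
    different from 1, so F(w) = 0. *)
Lemma kernel_functional :
  exists f : G -> algC,
    [/\ forall x y, phi x = 1%g -> f (x * y)%g = f x + f y,
        exists2 x, phi x = 1%g & f x != 0
      & forall x w M i, phi w = 1%g -> commute x w ->
          (phi x ^+ M)%g = (z0 ^+ i)%g -> (phi x ^+ M)%g != 1%g -> f w = 0].
Proof.
have phi1 : phi 1%g = 1%g by apply: (mulgI (phi 1%g)); rewrite -phiM !mulg1.
have [zeta pz] := C_prim_root_exists (order_gt0 z0).
pose U := central_eigenspace z0 zeta.
pose act x : 'End(subvs_of U) := (linfun (vsproj U) \o
  linfun (ffun_rtrans (phi x)) \o linfun vsval)%VF.
have actE x v : vsval (act x v) = ffun_rtrans (phi x) (vsval v).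
  rewrite 2!comp_lfunE !lfunE /= vsprojK //.
  exact/rtrans_eigenspace/subvsP.
have act_id x v : phi x = 1%g -> act x v = v.
  move=> x1; apply: val_inj; rewrite /= actE x1.
  by apply/ffunP => y; rewrite ffunE mulg1.
have act1 : act 1%g = \1%VF.
  by apply/lfunP => v; rewrite act_id // id_lfunE.
have actM x y : act (x * y)%g = (act x \o act y)%VF.
  apply/lfunP => v; rewrite comp_lfunE; apply: val_inj; rewrite /= !actE phiM.
  by apply/ffunP => h; rewrite !ffunE mulgA.
have V_gt0 : (0 < \dim (fullv : {vspace subvs_of U}))%N.
  by rewrite dimvf; exact: central_eigenspace_dim.
have [F FM Fnp] := nonprincipal_crossed_hom act1 actM V_gt0 X_gt2.
have FR x w : phi x = 1%g -> F (x * w)%g = F x + F w.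
  by move=> x1; rewrite FM act_id.
have [x0 x01 Fx0] : exists2 x, phi x = 1%g & F x != 0.
  apply: contrapT => noF.
  have F0 x : phi x = 1%g -> F x = 0.
    by move=> x1; apply/eqP/negPn/negP => nz; apply: noF; exists x.
  have Fphi x y : phi x = phi y -> F x = F y.
    move=> e; have k1 : phi (x^-1 * y)%g = 1%g.
      by apply: (mulgI (phi x)); rewrite -phiM mulVKg mulg1.
    by rewrite -[y](mulVKg x) FM (F0 _ k1) linear0 addr0.
  pose sec h := xget 1%g [set x | phi x = h].
  pose H := [set h | `[< exists x, phi x = h >]]%SET.
  have secP h : h \in H -> phi (sec h) = h.
    rewrite inE => /asboolP[x xh].
    by apply: (@xgetPex _ _ [set x | phi x = h]%classic); exists x.
  (* F descends to the finite image H, where it is the coboundary of minus its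
     average. *)
  pose S := \sum_(h in H) F (sec h).
  (* Sum the cocycle rule for x times [sec h] over [H], which left multiplication by [phi x]
     permutes. *)
  have SE x : S = F x *+ #|H| + act x S.
    rewrite /S linear_sum -sumr_const -big_split /=.
    rewrite (reindex_inj (mulgI (phi x))) /=.
    apply: eq_big => [h|h hH].
      rewrite !inE; apply: asbool_equiv_eq; split=> -[y yh].
        exists (x^-1 * y)%g; apply: (mulgI (phi x)).
        by rewrite -phiM mulKVg.
      by exists (x * y)%g; rewrite phiM yh.
    have hH' : h \in H.
      move: hH; rewrite !inE => -[y yh].
      exists (x^-1 * y)%g; apply: (mulgI (phi x)).
      by rewrite -phiM mulKVg.
    by rewrite -FM; apply: Fphi; rewrite phiM !secP.
  have H_nz : (#|H|%:R : algC) != 0.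
    rewrite Num.Theory.pnatr_eq0 -lt0n; apply/card_gt0P; exists 1%g.
    by rewrite inE; apply/asboolP; exists 1%g.
  have [x] := Fnp (- (#|H|%:R^-1 *: S)); apply.
  apply: (scalerI H_nz); rewrite scalerDr linearN linearZ /= !scalerN opprK.
  rewrite !scalerA mulfV // !scale1r {2}(SE x) scaler_nat.
  by rewrite addrC addrK.
have [y0 y0P] : exists y, vsval (F x0) y != 0.
  apply: contrapT => noy; case/eqP: Fx0; apply: val_inj => /=.
  apply/ffunP => y; rewrite [RHS]ffunE; apply/eqP/negPn/negP => nz.
  by apply: noy; exists y.
exists (fun x => vsval (F x) y0); split.
- by move=> x y x1; rewrite FR // ffunE.
- by exists x0.
move=> x w M i w1 xw xM xM1.
have fix1 : ffun_rtrans (phi x) (vsval (F w)) = vsval (F w).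
  rewrite -actE; congr vsval; apply: (addrI (F x)).
  by rewrite -FM xw FR // addrC.
have fixM j y : vsval (F w) (y * phi x ^+ j)%g = vsval (F w) y.
  elim: j => [|j IH]; first by rewrite mulg1.
  by rewrite expgSr mulgA -IH -{2}fix1 ffunE.
have /eqP : vsval (F w) y0 * (zeta ^+ i - 1) = 0.
  (* Centrality turns right translation by [z0 ^+ i] into left translation, which is multiplication
     by [zeta ^+ i]. *)
  rewrite mulrBr mulr1 -{2}(fixM M) xM.
  rewrite (commuteX i (commute_sym (z0_central y0))).
  by rewrite (central_eigenspaceX _ _ (subvsP _)) mulrC subrr.
rewrite mulf_eq0 => /orP[/eqP//|]; rewrite subr_eq0 -(prim_order_dvd pz).
by rewrite order_dvdn -xM (negPf xM1).
Qed.

End KernelFunctional.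

(** * Additivity of homology classes and functionals on [H1] *)

Section H1Theory.
Variable (G : groupType).

Lemma H1_pi_eq (A : zmodType) (c e : chain1 G A) :
  c - e \in @boundary1 G A -> \pi_(H1 G A) c = \pi_(H1 G A) e.
Proof. by rewrite Quotient.idealrBE => /eqP. Qed.

Lemma H1_piD (A : zmodType) (c e : chain1 G A) :
  \pi_(H1 G A) (c + e) = \pi_(H1 G A) c + \pi_(H1 G A) e.
Proof. by rewrite !piE. Qed.

Lemma H1_class_mul (A : zmodType) (a : A) (x y : G) :
  H1_class a (x * y)%g = H1_class a x + H1_class a y.
Proof.
rewrite /H1_class -H1_piD; apply/esym/H1_pi_eq/asboolP.
by exists [:: (a, x, y)]; rewrite big_seq1 /= [X in X - _]addrC addrAC.
Qed.

Lemma H1_classD (A : zmodType) (a b : A) (x : G) :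
  H1_class (a + b) x = H1_class a x + H1_class b x.
Proof. by rewrite /H1_class -H1_piD -monalgUD. Qed.

Lemma H1_class0 (A : zmodType) (x : G) : H1_class (0 : A) x = 0.
Proof. by apply: (addrI (H1_class 0 x)); rewrite -H1_classD !addr0. Qed.

(** An additive [f] kills bar boundaries, so its extension to 1-chains descends. Linearity is stated
    on finite rational combinations, the form in which elements of [lin_span] are given. *)
Lemma H1_functional (f : G -> algC) :
  (forall x y, f (x * y)%g = f x + f y) ->
  exists2 psi : H1 G rat -> algC,
    forall s : seq (rat * H1 G rat),
      psi (\sum_(p <- s) p.1 *: p.2) = \sum_(p <- s) ratr p.1 * psi p.2 &
    forall x, psi (H1_class 1 x) = f x.
Proof.
move=> fM; pose m := @mmap G rat algC ratr f.
have mU a x : m << a *g x >> = ratr a * f x by rewrite /m mmapU.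
have m_bd c : c \in @boundary1 G rat -> m c = 0.
  move=> /asboolP[s ->]; rewrite /m raddf_sum big1 // => -[[a x] y] _ /=.
  by rewrite raddfD raddfB /= !mmapU fM; ring.
pose psi (h : H1 G rat) := m (repr h).
have psi_pi c : psi (\pi c) = m c.
  apply: subr0_eq; rewrite /psi.
  have := m_bd (repr (\pi_(H1 G rat) c) - c); rewrite /m raddfB; apply.
  by rewrite Quotient.idealrBE reprK.
have psiZD k h h' : psi (k *: h + h') = ratr k * psi h + psi h'.
  elim/H1W: h => c; elim/H1W: h' => e.
  rewrite [_ *: _]H1_scale_pi -pi_H1D !psi_pi /m raddfD /=; congr (_ + _).
  rewrite (mmapEw (msuppZ_le _ _)) mmapE mulr_sumr.
  by apply: eq_bigr => x _; rewrite mcoeffZ /= rmorphM -[LHS]mulrA.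
have psi0 : psi 0 = 0.
  have := psiZD 1 0 0; rewrite scale1r addr0 rmorph1 mul1r.
  by move=> /(canLR (addrK _)); rewrite subrr.
exists psi => [s|x]; last by rewrite psi_pi mU rmorph1 mul1r.
by elim: s => [|p s IH]; rewrite ?big_nil // !big_cons psiZD IH.
Qed.

End H1Theory.

(** * Kernels as normal subgroups of finite index, and their primitive homology *)

Section Kernel.
Variables (G : groupType) (gT : finGroupType) (phi : G -> gT).
Hypothesis phiM : {morph phi : x y / (x * y)%g}.

Let phi1 : phi 1%g = 1%g.
Proof. by apply: (mulgI (phi 1%g)); rewrite -phiM !mulg1. Qed.

Let phiV x : phi x^-1%g = (phi x)^-1%g.
Proof. by apply: (mulgI (phi x)); rewrite -phiM !mulgV. Qed.

(** The morphism proof is an argument so that the closure instances, which depend on it, can be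
    attached to the predicate. *)
Definition hom_kernel (_ : {morph phi : x y / (x * y)%g}) : {pred G} :=
  fun x => phi x == 1%g.

Fact hom_kernelV : invg_closed (hom_kernel phiM).
Proof. by move=> x /eqP x1; apply/eqP; rewrite phiV x1 invg1. Qed.
Fact hom_kernelM : mulg_closed (hom_kernel phiM).
Proof. by move=> x y /eqP x1 /eqP y1; apply/eqP; rewrite phiM x1 y1 mulg1. Qed.
Fact hom_kernel1 : 1%g \in hom_kernel phiM.
Proof. exact/eqP. Qed.
HB.instance Definition _ := isInvClosed.Build G (hom_kernel phiM) hom_kernelV.
HB.instance Definition _ := isMulClosed.Build G (hom_kernel phiM) hom_kernelM.
HB.instance Definition _ := isMul1Closed.Build G (hom_kernel phiM) hom_kernel1.

Local Notation R := (GroupClosed.clone _ (hom_kernel phiM) _).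

Lemma hom_kernel_normal : normal_subgroup R.
Proof.
move=> x y /eqP x1; apply/eqP.
by rewrite conjgE !phiM x1 mul1g phiV mulVg.
Qed.

(** Left cosets correspond to points of the image of [phi], whose order divides that of [gT] by
    Lagrange. *)
Lemma hom_kernel_index :
  exists2 N, has_index R N & (N %| #|gT|)%N.
Proof.
pose H := [set h | `[< exists x, phi x = h >]]%SET.
have grH : group_set H.
  apply/group_setP; split=> [|h k]; first by rewrite inE; apply/asboolP; exists 1%g.
  by rewrite !inE => -[x <-] [y <-]; exists (x * y)%g; rewrite phiM.
exists #|H|; last first.
  have := cardSg (finset.subsetT (Group grH) : _ \subset [group of [set: gT]%SET]).
  by rewrite /= cardsT.
rewrite /has_index.
pose sec h := xget 1%g [set x | phi x = h].
have secP h : h \in H -> phi (sec h) = h.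
  rewrite inE => /asboolP[x xh].
  by apply: (@xgetPex _ _ [set x | phi x = h]%classic); exists x.
have cosP x y : left_coset R x = left_coset R y <-> phi x = phi y.
  split=> [e|e].
    have : left_coset R x x by exists 1%g; rewrite ?mulg1 //= hom_kernel1.
    by rewrite e => -[k /eqP k1 <-]; rewrite phiM k1 mulg1.
  apply/seteqP; split=> _ [k /eqP k1 <-];
    [exists (y^-1 * x * k)%g | exists (x^-1 * y * k)%g].
  - by apply/eqP; rewrite !phiM phiV e k1 mulVg mulg1.
  - by rewrite !mulgA mulgV mul1g.
  - by apply/eqP; rewrite !phiM phiV e k1 mulVg mulg1.
  - by rewrite !mulgA mulgV mul1g.
have -> : range (left_coset R) =
    (fun i : 'I_#|H| => left_coset R (sec (enum_val i))) @` setT.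
  apply/seteqP; split=> [_ [x _ <-]|_ [i _ <-]]; last by exists (sec (enum_val i)).
  have xH : phi x \in H by rewrite inE; apply/asboolP; exists x.
  exists (enum_rank_in xH (phi x)) => //; apply: (cosP _ _).2.
  by rewrite secP ?enum_valP // enum_rankK_in.
apply: card_eq_trans (inj_card_eq _) _; last by rewrite card_eq_sym card_II.
move=> i j _ _ /(cosP _ _).1; rewrite !secP ?enum_valP //; exact: enum_val_inj.
Qed.

End Kernel.

(** The functional of [kernel_functional] descends to [H1] of the kernel. A power of a loop in O_d
    commutes with that loop, so its class is killed, while the class of [x0] is not. *)
Lemma proper_prim_homology (X : finType) (r : seq (X * bool))
    (gT : finGroupType) (phi : presented_group [:: r] -> gT) (z0 : gT) (d : int)
    (M : nat) (phiM : {morph phi : x y / (x * y)%g}) :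
  (2 < #|X|)%N -> (forall y, commute z0 y) ->
  (forall x, exists i, (phi x ^+ M)%g = (z0 ^+ i)%g) ->
  (forall x, nonzero_mod_loops d x -> (phi x ^+ M)%g != 1%g) ->
  prim_homology d (GroupClosed.clone _ (hom_kernel phiM) _) <> [set: _].
Proof.
set R := GroupClosed.clone _ _ _.
move=> X2 z0C phiz0 phiO.
have [f [fM [x0 x01 fx0] f0]] := kernel_functional X2 phiM z0C.
have memR (y : subgroup R) : phi (val y) = 1%g by apply/eqP; exact: (valP y).
have [psi psiD psiE] := @H1_functional (subgroup R) (fun y => f (val y))
  (fun x y => fM _ _ (memR x)).
have x0R : x0 \in R by exact/eqP.
move=> primT; have : prim_homology d R (H1_class 1 (Sub x0 x0R : subgroup R)).
  by rewrite primT.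
case=> s sP /(congr1 psi); rewrite psiE psiD big_seq big1 => [/=|p ps].
  by move/eqP; rewrite (negPf fx0).
have [y [x xO [m ym]] <-] := sP p ps; rewrite psiE.
have [i xi] := phiz0 x.
rewrite (f0 x _ M i) ?mulr0 ?phiO //.
by rewrite ym; case: m {ym} => m; [|apply: commuteV]; apply: commuteX.
Qed.

(** * Exponent sums and homology modulo an integer *)

Section Exponents.
Variables (g n : nat).
Local Notation X := (surface_gen g n).

Definition letter_sign (l : X * bool) : int := if l.2 then -1 else 1.

Definition gen_exponent (s : X) (w : word X) : int :=
  \sum_(l <- w) (if l.1 == s then letter_sign l else 0).

(* The class of w vanishes in H_1(-; Z/e): the c_j satisfy the single relation
   sum_j c_j = 0, so only the differences of their exponents matter. *)
Definition trivial_mod (e : int) (w : word X) : Prop :=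
  (forall ib, (e %| gen_exponent (inl ib) w)%Z) /\
  (forall j j', (e %| gen_exponent (inr j) w - gen_exponent (inr j') w)%Z).

(** Tested on [repr x]: other words for [x] shift all puncture exponents by the same integer, so the
    condition depends on [x] alone. *)
Definition nontrivial_mod (e : int) : set (surface_group g n) :=
  [set x | ~ trivial_mod e (repr x)].

Lemma exponent_sum (A : zmodType) (a : X -> A) (w : word X) :
  \sum_(l <- w) a l.1 *~ letter_sign l =
  \sum_(ib : 'I_g * bool) a (inl ib) *~ gen_exponent (inl ib) w +
  \sum_(j : 'I_n) a (inr j) *~ gen_exponent (inr j) w.
Proof.
elim: w => [|[x b] w IH].
  rewrite big_nil !big1 ?addr0 // => i _; by rewrite /gen_exponent big_nil mulr0z.
have E s : gen_exponent s ((x, b) :: w) =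
    (if x == s then letter_sign (x, b) else 0) + gen_exponent s w.
  by rewrite /gen_exponent big_cons.
rewrite big_cons IH.
under [in RHS]eq_bigr do rewrite E mulrzDr.
under [X in _ = _ + X]eq_bigr do rewrite E mulrzDr.
rewrite !big_split /= addrACA; congr (_ + _).
case: x {E} => s.
  rewrite (bigD1 s) //= eqxx big1 ?addr0 => [|i /negPf ne].
    by rewrite big1 ?addr0 // => j _; rewrite mulr0z.
  rewrite (_ : (inl s == inl i :> X) = (s == i)) // eq_sym ne.
  by rewrite mulr0z.
rewrite big1 ?add0r => [|j _]; last by rewrite mulr0z.
rewrite (bigD1 s) //= eqxx big1 ?addr0 // => i /negPf ne.
rewrite (_ : (inr s == inr i :> X) = (s == i)) // eq_sym ne.
by rewrite mulr0z.
Qed.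

End Exponents.

Lemma H1_classMz (G : groupType) (A : zmodType) (a : A) (x : G) k :
  H1_class (a *~ k) x = H1_class a x *~ k.
Proof.
have nat_case m : H1_class (a *+ m) x = H1_class a x *+ m.
  by elim: m => [|m IH]; rewrite ?H1_class0 // !mulrS H1_classD IH.
case: k => m; first exact: nat_case.
rewrite NegzE !mulrNz -!pmulrn; apply/eqP.
by rewrite -addr_eq0 -nat_case -H1_classD addNr H1_class0.
Qed.

Section Abelianization.
Variables (g n : nat).
Local Notation X := (surface_gen g n).
Local Notation G := (surface_group g n).
Local Notation "[ w ]" := (word_class [:: surface_relator g n] w).

Section Character.
Variables (A : zmodType) (chi : G -> A).
Hypothesis chiM : forall x y, chi (x * y)%g = chi x + chi y.
Let a (s : X) := chi [ [:: (s, false)] ].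

Lemma character_exponent (w : word X) :
  chi [w] = \sum_(ib : 'I_g * bool) a (inl ib) *~ gen_exponent (inl ib) w +
            \sum_(j : 'I_n) a (inr j) *~ gen_exponent (inr j) w.
Proof.
have chi1 : chi 1%g = 0.
  by apply: (addrI (chi 1%g)); rewrite -chiM mulg1 addr0.
rewrite -exponent_sum; elim: w => [|[s b] w IH]; first by rewrite big_nil -chi1.
rewrite big_cons -IH (_ : [ _ ] = [ [:: (s, b)] ] * [w])%g.
  rewrite chiM; congr (_ + _).
  case: b; rewrite ?mulr1z // mulrN1z; apply/eqP; rewrite -addr_eq0 -chiM.
  rewrite -word_classM.
  by rewrite (word_class_cancel [:: surface_relator g n] (s, true)) chi1.
by rewrite -word_classM.
Qed.

Lemma exponent_relator s :
  gen_exponent s (surface_relator g n) = (if s is inr _ then 1 else 0).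
Proof.
rewrite /gen_exponent /surface_relator big_cat /= big_flatten big_map /=.
rewrite big1 ?add0r => [|i _]; last first.
  rewrite !big_cons big_nil /= addr0.
  by case: ifP => _; case: ifP.
rewrite big_map big_enum /=; case: s => s; first by rewrite big1.
rewrite (bigD1 s) //= eqxx big1 ?addr0 // => i /negPf ne.
by rewrite (_ : (inr i == inr s :> X) = (i == s)) // ne.
Qed.

(** Evaluating [chi] on the relator shows that the puncture values sum to 0. Modulo [e] all puncture
    exponents equal one of them, so the puncture terms cancel together; each handle term vanishes by
    itself. *)
Lemma character_trivial_mod (e : int) w :
  (forall s, a s *~ e = 0) -> trivial_mod e w -> chi [w] = 0.
Proof.
move=> ae [t1 t2].
have aE s k : (e %| k)%Z -> a s *~ k = 0.
  by move=> /dvdzP[q ->]; rewrite mulrC mulrzA ae mul0rz.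
rewrite character_exponent big1 ?add0r => [|ib _]; last exact/aE/t1.
have : \sum_(j : 'I_n) a (inr j) = 0.
  have := character_exponent (surface_relator g n).
  rewrite word_class_rel ?mem_head // big1 ?add0r => [|ib _]; last first.
    by rewrite exponent_relator mulr0z.
  have -> : chi 1%g = 0.
    by apply: (addrI (chi 1%g)); rewrite -chiM mulg1 addr0.
  move=> {2}->; apply: eq_bigr => j _; by rewrite exponent_relator mulr1z.
move=> sum0; case: (pickP (fun _ : 'I_n => true)) => [j0 _|no_j]; last first.
  by rewrite big1 // => j; have := no_j j.
transitivity (\sum_(j : 'I_n) a (inr j) *~ gen_exponent (inr j0) w).
  apply: eq_bigr => j _; apply/eqP; rewrite -subr_eq0 -mulrzBr.
  by rewrite aE.
by rewrite -mulrz_suml sum0 mul0rz.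
Qed.

End Character.

(** Apply [character_trivial_mod] to the character sending an element to its own class with
    coefficient 1 modulo [d]; its values are killed by [d] because the coefficient is. *)
Lemma nonzero_nontrivial d x : nonzero_mod_loops d x -> @nontrivial_mod g n d x.
Proof.
move=> /= /eqP nz triv; apply: nz.
have /= := @character_trivial_mod _ (fun y => H1_class (\pi_(Zmod d) 1 : Zmod d) y)
  (fun u v => H1_class_mul _ u v) d (repr x).
rewrite /word_class reprK; apply=> // s; rewrite -H1_classMz.
rewrite (_ : _ *~ d = 0) ?H1_class0 //.
rewrite -[LHS](raddfMz (\pi_(Zmod d) : int -> Zmod d)) intz.
rewrite -[RHS](raddf0 (\pi_(Zmod d) : int -> Zmod d)).
by apply/eqP; rewrite -Quotient.idealrBE subr0; exact: dvdzz.
Qed.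

End Abelianization.

(** * Detecting finite quotients and the reduction to primes *)

(** The divisibility of [#|gT|] controls the degree of the cover; together with that of [M] it keeps
    the quotients for coprime [e] from interfering. *)
Definition detected (g n e : nat) : Prop :=
  exists (gT : finGroupType) (phi : surface_group g n -> gT) (z0 : gT)
    (M k : nat),
    [/\ {morph phi : x y / (x * y)%g}, forall y, commute z0 y,
        (#|gT| %| e ^ k)%N, (M %| e ^ k)%N &
        forall x, exists2 i, (phi x ^+ M)%g = (z0 ^+ i)%g &
                             nontrivial_mod e x -> (phi x ^+ M)%g != 1%g].

Lemma detected1 g n : detected g n 1.
Proof.
exists 'S_1, (fun=> 1%g), 1%g, 1%N, 0%N; split=> //.
- by move=> x y; rewrite mulg1.
- by move=> y; exact: commute_sym (commute1 y).
- by rewrite card_Sn.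
move=> x; exists 0%N => // nt; case: nt.
by split=> *; rewrite dvd1z.
Qed.

Lemma order_dvd_card (gT : finGroupType) (x : gT) : (#[x]%g %| #|gT|)%N.
Proof.
rewrite -finset.cardsT.
by apply: (@order_dvdG _ [group of [set: gT]%SET]); rewrite inE.
Qed.

Lemma expg_neq1_coprime (gT : finGroupType) (x : gT) m :
  coprime #|gT| m -> x != 1%g -> (x ^+ m)%g != 1%g.
Proof.
move=> co; apply: contra; rewrite -order_dvdn -order_eq1 -dvdn1 => xm.
have := order_dvd_card x.
move=> xg; have : (#[x]%g %| gcdn #|gT| m)%N by rewrite dvdn_gcd xg xm.
by rewrite (eqP co).
Qed.

(** Take the product of the two quotients and the power [M1 * M2]. Raising to the exponent of the
    other factor, coprime to the group order, preserves nontriviality. *)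
Lemma detectedM g n e1 e2 : coprime e1 e2 ->
  detected g n e1 -> detected g n e2 -> detected g n (e1 * e2).
Proof.
move=> co [gT1 [phi1 [z1 [M1 [k1 [morph1 cent1 card1 M1e det1]]]]]].
move=> [gT2 [phi2 [z2 [M2 [k2 [morph2 cent2 card2 M2e det2]]]]]].
have co12 : coprime (e1 ^ k1) (e2 ^ k2) by rewrite coprimeXl ?coprimeXr.
have pX (u : gT1) (v : gT2) i : ((u, v) ^+ i)%g = (u ^+ i, v ^+ i)%g.
  by elim: i => // i IH; rewrite !expgS IH.
have dvd_k a b : (a %| e1 ^ k1)%N -> (b %| e2 ^ k2)%N ->
    (a * b %| (e1 * e2) ^ (k1 + k2))%N.
  move=> a1 b2; apply: dvdn_trans (dvdn_mul a1 b2) _.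
  by rewrite expnMn dvdn_mul // dvdn_exp2l ?leq_addr ?leq_addl.
exists (gT1 * gT2)%type, (fun x => (phi1 x, phi2 x)), (z1, z2),
  (M1 * M2)%N, (k1 + k2)%N; split.
- by move=> x y; rewrite morph1 morph2.
- by move=> [u v]; rewrite /commute /= [LHS](_ : _ = (z1 * u, z2 * v)%g) // cent1 cent2.
- by rewrite card_prod dvd_k.
- exact: dvd_k.
move=> x; have [i1 e1x nt1] := det1 x; have [i2 e2x nt2] := det2 x.
have E : ((phi1 x, phi2 x) ^+ (M1 * M2) =
  ((phi1 x ^+ M1) ^+ M2, (phi2 x ^+ M2) ^+ M1))%g.
  by rewrite pX expgM mulnC expgM.
have coz : coprime #[z1]%g #[z2]%g.
  have z1g := order_dvd_card z1.
  have z2g := order_dvd_card z2.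
  apply: coprime_dvdl (dvdn_trans z1g card1) _.
  exact: coprime_dvdr (dvdn_trans z2g card2) _.
(* The orders of [z1] and [z2] are coprime, so one exponent of [(z1, z2)] realizes both
   components. *)
exists (chinese #[z1]%g #[z2]%g (i1 * M2) (i2 * M1)).
  rewrite E pX e1x e2x -!expgM; congr pair; apply/eqP; rewrite eq_expg_mod_order.
    by rewrite chinese_modl.
  by rewrite chinese_modr.
rewrite E => nt; apply/eqP => -[eq1 eq2]; apply: nt.
have co1 : coprime #|gT1| M2.
  by apply: coprime_dvdl card1 _; apply: coprime_dvdr M2e _.
have co2 : coprime #|gT2| M1.
  by apply: coprime_dvdl card2 _; apply: coprime_dvdr M1e _; rewrite coprime_sym.
have [t1a t1b] : trivial_mod e1 (repr x).
  apply: contrapT => /nt1/(expg_neq1_coprime co1).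
  by rewrite eq1 eqxx.
have [t2a t2b] : trivial_mod e2 (repr x).
  apply: contrapT => /nt2/(expg_neq1_coprime co2).
  by rewrite eq2 eqxx.
have cz : coprimez e1 e2 by rewrite /coprimez /gcdz.
by split=> *; rewrite PoszM Gauss_dvdz // ?t1a ?t1b ?t2a ?t2b.
Qed.

Lemma detected_squarefree g n e :
  (forall p, prime p -> detected g n p) ->
  (0 < e)%N -> (forall m, (m * m %| e)%N -> m = 1%N) -> detected g n e.
Proof.
move=> detp; elim/ltn_ind: e => e IH e_gt0 sqf.
have [->|e_neq1] := eqVneq e 1%N; first exact: detected1.
have e_gt1 : (1 < e)%N by rewrite ltn_neqAle eq_sym e_neq1.
have pr_p := pdiv_prime e_gt1; have p_gt1 := prime_gt1 pr_p.
have De := divnK (pdiv_dvd e).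
set p := pdiv e in pr_p p_gt1 De.
have q_gt0 : (0 < e %/ p)%N by rewrite divn_gt0 ?prime_gt0 // dvdn_leq ?pdiv_dvd.
rewrite -De; apply: detectedM; last exact: detp.
  rewrite coprime_sym prime_coprime //; apply/negP => pq.
  have /sqf p1 : (p * p %| e)%N by rewrite -De dvdn_mul.
  by rewrite p1 in p_gt1.
apply: IH => // [|m mq]; first by rewrite -[X in (_ < X)%N]De ltn_Pmulr.
by apply: sqf; rewrite -De; exact: dvdn_mulr.
Qed.

Lemma detected_proper g n (d : int) : (2 <= g)%N -> squarefree d ->
  (forall p, prime p -> detected g n p) ->
  exists (R : groupClosed (surface_group g n)) (N k : nat),
    [/\ normal_subgroup R, has_index R N, (N%:Z %| d ^+ k)%Z
      & prim_homology d R <> [set: H1 (subgroup R) rat]].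
Proof.
move=> g_ge2 sqf detp.
have d_gt0 : (0 < `|d|)%N.
  (* 0 is not square-free: 4 divides it and 2 is not a unit. *)
  rewrite absz_gt0; apply/eqP => d0.
  by have := sqf 2; rewrite d0 dvdz0 => /(_ isT).
have [|gT [phi [z0 [M [k [phiM z0C cardk Mk det]]]]]] :=
    detected_squarefree detp d_gt0.
  by move=> m mm; have /orP[/eqP[]|/eqP] := sqf m%:Z mm.
have dvdE (a b : int) : (a %| b)%Z = (`|a| %| `|b|)%N by [].
have [N idx Ng] := hom_kernel_index phiM.
exists (GroupClosed.clone _ (hom_kernel phiM) _), N, k; split => //.
- exact: hom_kernel_normal.
- by rewrite dvdE abszX (dvdn_trans Ng).
have := @proper_prim_homology ('I_g * bool + 'I_n)%type (surface_relator g n)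
  gT phi z0 d M phiM; apply => //.
- rewrite card_sum card_prod !card_ord card_bool; lia.
- by move=> x; have [i xi _] := det x; exists i.
move=> x /nonzero_nontrivial nt; have [i _] := det x; apply.
move=> [t1 t2]; apply: nt.
by split=> *; [apply: t1|apply: t2].
Qed.

(* [GL_finGroup] and [GL_mx] fix one path to the group structure of {'GL_n[L]};
   comparing the paths by unfolding matrices is very slow. *)
Definition GL_finGroup (L : finFieldType) m : finGroupType := {'GL_m.+1[L]}.

Definition GL_mx (L : finFieldType) m (x : GL_finGroup L m) : 'M[L]_m.+1 :=
  GLval x.

Lemma GL_mxM (L : finFieldType) m (x y : GL_finGroup L m) :
  GL_mx (x * y)%g = GL_mx x * GL_mx y.
Proof. by []. Qed.

Lemma GL_mx1 (L : finFieldType) m : GL_mx (1%g : GL_finGroup L m) = 1.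
Proof. by []. Qed.

Lemma GL_mx_inj (L : finFieldType) m : injective (@GL_mx L m).
Proof. exact: val_inj. Qed.

(** * Unitriangular matrices with Frobenius-twisted superdiagonal *)

Section Ladder.
Variables (p : nat) (L : finFieldType).
Hypothesis pcharL : p \in [pchar L].

Lemma exprDpX (a b : L) k : (a + b) ^+ (p ^ k) = a ^+ (p ^ k) + b ^+ (p ^ k).
Proof.
have pr_p := pcharf_prime pcharL.
rewrite exprDn_pchar // pnatX.
by rewrite (eq_pnat _ (pcharf_eq pcharL)) pnat_id.
Qed.

(* The matrix of 1 + a t + ... in the twisted polynomial ring: above the diagonal
   stand the Frobenius conjugates a^(p^(m-1)), ..., a^p, a, from top to bottom. *)
Definition ladder m (a : L) (X : 'M[L]_m.+1) : Prop :=
  forall i j : 'I_m.+1,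
    [/\ (j < i)%N -> X i j = 0, j = i -> X i j = 1 &
        j = i.+1 :> nat -> X i j = a ^+ (p ^ (m - j))].

Lemma upper_mul_entry m (X Y : 'M[L]_m.+1) i j :
  (forall i k : 'I_m.+1, (k < i)%N -> X i k = 0) ->
  (forall i k : 'I_m.+1, (k < i)%N -> Y i k = 0) ->
  (X * Y) i j = \sum_(k < m.+1 | (i <= k <= j)%N) X i k * Y k j.
Proof.
move=> X0 Y0; rewrite mxE (bigID (fun k : 'I_m.+1 => (i <= k <= j)%N)) /=.
rewrite [X in _ + X]big1 ?addr0 // => k.
rewrite negb_and -!ltnNge => /orP[ki|jk]; first by rewrite X0 ?mul0r.
by rewrite Y0 ?mulr0.
Qed.

Section Size.
Variable m : nat.
Implicit Types (X Y : 'M[L]_m.+1) (a b : L) (i j : 'I_m.+1).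

Lemma ladder_upper a X i j : ladder a X -> (j < i)%N -> X i j = 0.
Proof. by move=> /(_ i j)[]. Qed.

Lemma ladder_diag a X i : ladder a X -> X i i = 1.
Proof. by move=> /(_ i i)[_ ->]. Qed.

Lemma ladder_super a X i j : ladder a X -> j = i.+1 :> nat ->
  X i j = a ^+ (p ^ (m - j)).
Proof. by move=> /(_ i j)[]. Qed.

Lemma ladder1 : ladder 0 (1 : 'M[L]_m.+1).
Proof.
have pr_p := pcharf_prime pcharL.
move=> i j; split=> [ji|->|ji]; rewrite mxE ?eqxx //.
  by rewrite -val_eqE /= gtn_eqF.
by rewrite -val_eqE /= ji ltn_eqF // expr0n expn_eq0 -leqn0 leqNgt prime_gt0.
Qed.

(** On the superdiagonal only the indices [i] and [j] contribute, and Frobenius powers are additive;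
    hence labels add. *)
Lemma ladderM a b X Y : ladder a X -> ladder b Y -> ladder (a + b) (X * Y).
Proof.
move=> lX lY i j.
rewrite upper_mul_entry; [|by move=> *; exact: ladder_upper lX _..|
  by move=> *; exact: ladder_upper lY _].
split=> [ji|->|ji].
- by rewrite big_pred0 // => k; apply/negbTE; lia.
- rewrite (big_pred1 i) ?(ladder_diag _ lX) ?(ladder_diag _ lY) ?mulr1 // => k.
  by rewrite /= -val_eqE /=; lia.
rewrite (bigD1 i) /=; last by rewrite ji; lia.
rewrite (big_pred1 j) => [|k]; last by rewrite /= -!val_eqE /=; lia.
rewrite (ladder_diag _ lX) (ladder_diag _ lY) mul1r mulr1.
by rewrite (ladder_super lX) // (ladder_super lY) // exprDpX addrC.
Qed.

Lemma ladder_unit a X : ladder a X -> X \is a GRing.unit.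
Proof.
move=> lX; rewrite -[_ \is a _]/(X \in unitmx) unitmxE -det_tr det_trig.
  by rewrite big1 ?unitr1 // => i _; rewrite mxE (ladder_diag _ lX).
by apply/is_trig_mxP => i j ij; rewrite mxE (ladder_upper lX).
Qed.

Definition ladder_mx a : 'M[L]_m.+1 :=
  \matrix_(i, j) if j == i then 1
                 else if (j == i.+1 :> nat) then a ^+ (p ^ (m - j)) else 0.

Lemma ladder_mxP a : ladder a (ladder_mx a).
Proof.
move=> i j; rewrite mxE -val_eqE /=; split=> [ji|->|->]; rewrite ?eqxx //.
  by rewrite !ltn_eqF // ltnW.
by rewrite gtn_eqF.
Qed.

Definition ladder_group : {set GL_finGroup L m} :=
  [set x | `[< exists a, ladder a (GL_mx x) >]]%SET.

Lemma ladder_groupP x :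
  reflect (exists a, ladder a (GL_mx x)) (x \in ladder_group).
Proof. by rewrite inE; exact: asboolP. Qed.

Lemma ladder_group_set : group_set ladder_group.
Proof.
apply/group_setP; split.
  by apply/ladder_groupP; exists 0; rewrite GL_mx1; exact: ladder1.
move=> x y /ladder_groupP[a ax] /ladder_groupP[b bx].
by apply/ladder_groupP; exists (a + b); rewrite GL_mxM; exact: ladderM.
Qed.
Canonical ladder_groupG := Group ladder_group_set.

Lemma ladder_GL_M a b (x y : GL_finGroup L m) :
  ladder a (GL_mx x) -> ladder b (GL_mx y) -> ladder (a + b) (GL_mx (x * y)%g).
Proof. by rewrite GL_mxM; exact: ladderM. Qed.

(** The last superdiagonal entry of the product, where the Frobenius exponent is 1, reads a + b = 0.
    In size 1 there is no superdiagonal and any label fits. *)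
Lemma ladder_inverse a b X Y :
  ladder a X -> ladder b Y -> X * Y = 1 -> ladder (- a) Y.
Proof.
move=> lX lY XY1; have l1 := ladderM lX lY; rewrite {}XY1 in l1.
have [m0|m_gt0] := posnP m.
  move=> i j; split=> [ji|->|ji]; first exact: ladder_upper lY ji.
    exact: ladder_diag lY.
  by have := ltn_ord j => /= jm; exfalso; lia.
have Em : (inord m.-1 : 'I_m.+1) = m.-1 :> nat by rewrite inordK // ltnS leq_pred.
have Em1 : (ord_max : 'I_m.+1) = (inord m.-1 : 'I_m.+1).+1 :> nat.
  by rewrite Em prednK.
have ne : (inord m.-1 == ord_max :> 'I_m.+1) = false.
  by rewrite -val_eqE [X in _ == X]Em1; apply: ltn_eqF.
have := ladder_super l1 Em1; rewrite mxE ne /= subnn expr1.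
by move=> /esym/eqP; rewrite addr_eq0 => /eqP->; rewrite opprK.
Qed.

(** The inverse is the power [x ^+ #[x].-1], hence a ladder with some label, which [ladder_inverse]
    identifies. *)
Lemma ladder_GL_V a (x : GL_finGroup L m) :
  ladder a (GL_mx x) -> ladder (- a) (GL_mx x^-1%g).
Proof.
move=> lx.
have lX k : ladder (a *+ k) (GL_mx (x ^+ k)%g).
  elim: k => [|k IH]; first by rewrite GL_mx1; exact: ladder1.
  by rewrite expgS mulrS; exact: ladder_GL_M.
have e : GL_mx x * GL_mx (x ^+ #[x].-1)%g = 1.
  by rewrite -GL_mxM -expgS (prednK (order_gt0 x)) expg_order GL_mx1.
by rewrite invg_expg; exact: ladder_inverse lx (lX _) e.
Qed.

Lemma ladder_GL_comm a b (x y : GL_finGroup L m) :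
  ladder a (GL_mx x) -> ladder b (GL_mx y) ->
  ladder 0 (GL_mx (x * y * x^-1 * y^-1)%g).
Proof.
move=> lx ly; have := ladder_GL_M (ladder_GL_M (ladder_GL_M lx ly)
  (ladder_GL_V lx)) (ladder_GL_V ly).
by rewrite (_ : a + b - a - b = 0) //; ring.
Qed.

Lemma ladder_GL_prod (I : Type) (s : seq I) (a : I -> L)
    (x : I -> GL_finGroup L m) :
  (forall k, ladder (a k) (GL_mx (x k))) ->
  ladder (\sum_(k <- s) a k) (GL_mx (\prod_(k <- s) x k)%g).
Proof.
move=> lx; elim: s => [|k s IH]; first by rewrite !big_nil GL_mx1; exact: ladder1.
by rewrite !big_cons; exact: ladder_GL_M.
Qed.

End Size.

Section Corner.
Variable m : nat.
Local Notation gL := (GL_finGroup L m.+2).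
(* The entry (0, 2), which makes the upper left 3x3 block a Heisenberg group. *)
Let corner (x : gL) := GL_mx x ord0 (inord 2).

Lemma cornerM a b (x y : gL) : ladder a (GL_mx x) -> ladder b (GL_mx y) ->
  corner (x * y)%g =
  corner x + corner y + a ^+ (p ^ m.+1) * b ^+ (p ^ m).
Proof.
move=> lX lY; rewrite /corner GL_mxM.
rewrite upper_mul_entry; [|by move=> *; exact: ladder_upper lX _..|
  by move=> *; exact: ladder_upper lY _].
have i2 : (inord 2 : 'I_m.+3) = 2 :> nat by rewrite inordK.
have i1 : (inord 1 : 'I_m.+3) = 1%N :> nat by rewrite inordK.
rewrite (bigD1 ord0) /=; last by rewrite i2.
rewrite (bigD1 (inord 1)) /=; last by rewrite -val_eqE /= i1 i2.
rewrite (big_pred1 (inord 2)) => [|k]; last first.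
  by rewrite /= -!val_eqE /= i1 i2; lia.
rewrite (ladder_diag _ lX) (ladder_diag _ lY) mul1r mulr1.
rewrite (@ladder_super _ _ _ ord0 (inord 1) lX) ?i1 //.
rewrite (@ladder_super _ _ _ (inord 1) (inord 2) lY) ?i1 ?i2 //.
by rewrite /= !subSS !subn0; ring.
Qed.

(** Comparing corners in c y x = x y avoids computing inverses; [c] has label 0, so its product with
    y x has no cross term. *)
Lemma corner_comm a b (x y : gL) : ladder a (GL_mx x) -> ladder b (GL_mx y) ->
  corner (x * y * x^-1 * y^-1)%g = (a ^+ p * b - b ^+ p * a) ^+ (p ^ m).
Proof.
have pr_p := pcharf_prime pcharL.
move=> lx ly; set c := (x * y * _ * _)%g.
have e : (c * (y * x) = x * y)%g by rewrite /c !mulgA !mulgKV.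
have := congr1 corner e.
rewrite (cornerM (ladder_GL_comm lx ly) (ladder_GL_M ly lx)).
rewrite expr0n expn_eq0 -leqn0 leqNgt prime_gt0 //= mul0r addr0.
rewrite (cornerM ly lx) (cornerM lx ly).
move=> /(canRL (addrK _)) ->.
have NpX (u v : L) : (u - v) ^+ (p ^ m) = u ^+ (p ^ m) - v ^+ (p ^ m).
  by apply/eqP; rewrite -subr_eq opprK -exprDpX subrK.
rewrite NpX !exprMn -!exprM -!expnS; ring.
Qed.

Lemma corner_prod (I : Type) (s : seq I) (x : I -> gL) :
  (forall i, ladder 0 (GL_mx (x i))) ->
  corner (\prod_(i <- s) x i)%g = \sum_(i <- s) corner (x i).
Proof.
have pr_p := pcharf_prime pcharL.
move=> lx; elim: s => [|i s IH].
  by rewrite !big_nil /corner GL_mx1 mxE -val_eqE /= inordK.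
have := @ladder_GL_prod _ _ s (fun=> 0) x lx; rewrite big1 // => l0.
rewrite !big_cons (cornerM (lx i) l0) IH expr0n expn_eq0 -leqn0 leqNgt.
by rewrite prime_gt0 //= mul0r addr0.
Qed.

End Corner.

End Ladder.

(** * Enlarging a matrix by one row on top *)

Section BlockExtension.
Variables (L : finFieldType) (m : nat).
Implicit Types (v w : 'rV[L]_m.+1) (x y : GL_finGroup L m).

Fact ext_mx_unit v x :
  (block_mx 1%:M v 0 (GL_mx x) : 'M[L]_m.+2) \is a GRing.unit.
Proof.
rewrite -[_ \is a _]/(_ \in unitmx) unitmxE (det_ublock (1%:M : 'M_1)) det1 mul1r.
by rewrite -unitmxE; exact: (valP x).
Qed.

Definition GL_ext v x : GL_finGroup L m.+1 := FinRing.Unit (ext_mx_unit v x).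

Lemma GL_ext_mx v x : GL_mx (GL_ext v x) = block_mx 1%:M v 0 (GL_mx x).
Proof. by []. Qed.

Lemma GL_ext_entry v x : ((GL_mx (GL_ext v x) ord0 ord0 = 1) *
  (forall j, GL_mx (GL_ext v x) ord0 (lift ord0 j) = v 0 j) *
  (forall i, GL_mx (GL_ext v x) (lift ord0 i) ord0 = 0) *
  (forall i j, GL_mx (GL_ext v x) (lift ord0 i) (lift ord0 j) = GL_mx x i j))%type.
Proof.
have E0 : ord0 = @lshift 1 m.+1 ord0 by apply: val_inj.
have E1 (j : 'I_m.+1) : lift ord0 j = rshift 1 j by rewrite rshift1.
rewrite GL_ext_mx; do !split.
- by rewrite E0 (@block_mxEul _ 1 m.+1 1 m.+1) mxE.
- by move=> j; rewrite E1 E0 (@block_mxEur _ 1 m.+1 1 m.+1).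
- by move=> i; rewrite E1 E0 (@block_mxEdl _ 1 m.+1 1 m.+1) mxE.
by move=> i j; rewrite !E1 (@block_mxEdr _ 1 m.+1 1 m.+1).
Qed.

Lemma GL_extM v w x y :
  (GL_ext v x * GL_ext w y)%g = GL_ext (w + v *m GL_mx y) (x * y)%g.
Proof.
apply: GL_mx_inj; rewrite GL_mxM !GL_ext_mx GL_mxM.
have := mulmx_block (1%:M : 'M_1) v 0 (GL_mx x) 1%:M w 0 (GL_mx y).
by rewrite !mul1mx !mulmx0 !mul0mx !addr0 add0r.
Qed.

Lemma GL_ext01 : GL_ext 0 1%g = 1%g.
Proof.
apply: GL_mx_inj; rewrite GL_ext_mx !GL_mx1.
exact: (esym (@scalar_mx_block _ 1 m.+1 1)).
Qed.

Lemma GL_extV v x :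
  (GL_ext v x)^-1%g = GL_ext (- (v *m GL_mx x^-1%g)) x^-1%g.
Proof.
by apply: (mulgI (GL_ext v x)); rewrite GL_extM !mulgV addNr GL_ext01.
Qed.

(** A relation rather than a map, since deleting the first row and column is multiplicative only on
    such block matrices. *)
Definition GL_covers (y' : GL_finGroup L m.+1) y : Prop := exists v, y' = GL_ext v y.

Lemma GL_coversM (x' y' : GL_finGroup L m.+1) x y :
  GL_covers x' x -> GL_covers y' y -> GL_covers (x' * y')%g (x * y)%g.
Proof. by move=> [v ->] [w ->]; rewrite GL_extM; eexists. Qed.

Lemma GL_coversV (x' : GL_finGroup L m.+1) x :
  GL_covers x' x -> GL_covers x'^-1%g x^-1%g.
Proof. by move=> [v ->]; rewrite GL_extV; eexists. Qed.

Lemma GL_covers_prod (I : Type) (s : seq I) (f' : I -> GL_finGroup L m.+1) f :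
  (forall i, GL_covers (f' i) (f i)) ->
  GL_covers (\prod_(i <- s) f' i)%g (\prod_(i <- s) f i)%g.
Proof.
move=> ff; elim: s => [|i s IH]; last by rewrite !big_cons; exact: GL_coversM.
by rewrite !big_nil; exists 0; rewrite GL_ext01.
Qed.

End BlockExtension.

(** * Solving the closed surface relation row by row *)

Section ClosedSurface.
Variables (p : nat) (L : finFieldType).
Hypothesis pcharL : p \in [pchar L].

Lemma ladder_ext m a (x : GL_finGroup L m) (v : 'rV[L]_m.+1) :
  ladder p a (GL_mx x) -> v 0 ord0 = a ^+ (p ^ m) ->
  ladder p a (GL_mx (GL_ext v x)).
Proof.
move=> lx v0 i j.
case: (unliftP ord0 i) => [i'|] ->; case: (unliftP ord0 j) => [j'|] ->;
  rewrite !GL_ext_entry ?lift0.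
- have [l1 l2 l3] := lx i' j'; split=> [|/lift_inj|[ji]] //.
  by rewrite l3 // subSS.
- by split=> // /eqP; rewrite eq_liftF.
- split=> [//|e|[j0]]; first by have := congr1 val e.
  have -> : j' = ord0 by apply: val_inj.
  by rewrite v0 subSS subn0.
by split.
Qed.

Definition first_row m (a : L) : 'rV[L]_m.+1 := \row_j (if j == ord0 then a else 0).

Lemma ladder_ext_first_row m a (x : GL_finGroup L m) : ladder p a (GL_mx x) ->
  ladder p a (GL_mx (GL_ext (first_row m (a ^+ (p ^ m))) x)).
Proof. by move/ladder_ext; apply; rewrite mxE eqxx. Qed.

Lemma ext_ladder_mx1 m (x : GL_finGroup L m) : GL_mx x = ladder_mx p m 1 ->
  GL_mx (GL_ext (first_row m 1) x) = ladder_mx p m.+1 1.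
Proof.
move=> ex; apply/matrixP => i j.
case: (unliftP ord0 i) => [i'|] ->; case: (unliftP ord0 j) => [j'|] ->;
  rewrite !GL_ext_entry ?ex !mxE !expr1n ?lift0 ?eqxx //.
Qed.

Lemma row_mul_upper m k (z : 'rV[L]_m.+1) (X : 'M[L]_m.+1) :
  (forall j : 'I_m.+1, (j < k)%N -> z 0 j = 0) ->
  (forall i j : 'I_m.+1, (j < i)%N -> X i j = 0) ->
  forall j : 'I_m.+1, (j < k)%N -> (z *m X) 0 j = 0.
Proof.
move=> z0 X0 j jk; rewrite mxE big1 // => i _.
have [ik|ki] := ltnP i k; first by rewrite z0 ?mul0r.
by rewrite X0 ?mulr0 // (leq_trans jk).
Qed.

(** [ladder_mx p m 1] is 1 plus the shift, so the equation says that w_0 = 0 and u_(j-1) = w_j for j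
    > 0. Then w_1 = 0 gives u_0 = 0; the last coordinate of [u] is free and set to 0. *)
Lemma solve_shift m (w : 'rV[L]_m.+1) :
  (forall j : 'I_m.+1, (j < 2)%N -> w 0 j = 0) ->
  exists2 u : 'rV[L]_m.+1, u 0 ord0 = 0 & u *m ladder_mx p m 1 = u + w.
Proof.
move=> w0.
exists (\row_j (if (j < m)%N then w 0 (inord j.+1) else 0)).
  by rewrite mxE; case: ifP => // m0; rewrite w0 // inordK.
apply/rowP => j; rewrite mxE (bigD1 j) //= !mxE eqxx mulr1; congr (_ + _).
have [j0|j_gt0] := posnP j.
  rewrite w0 ?j0 // big1 // => i ij; rewrite [X in _ * X]mxE eq_sym (negPf ij).
  by rewrite j0 mulr0.
have jm : (j.-1 < m)%N by rewrite prednK //; have := ltn_ord j.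
have Ej : (inord j.-1 : 'I_m.+1) = j.-1 :> nat by rewrite inordK // ltnW.
rewrite (bigD1 (inord j.-1)) /=; last first.
  by apply/eqP => e; move: Ej; rewrite e => Ej; lia.
rewrite big1 ?addr0 => [|i /andP[ij ij']]; last first.
  rewrite [X in _ * X]mxE eq_sym (negPf ij) ifF ?mulr0 //.
  apply: contraNF ij' => /eqP e; apply/eqP/val_inj => /=.
  by rewrite Ej e.
rewrite !mxE Ej jm prednK // eqxx expr1n ifF ?mulr1.
  by congr (w 0 _); apply: val_inj; rewrite /= inordK.
by apply/eqP => e; move: Ej; rewrite -e => Ej; lia.
Qed.

Definition commutator_prod (gT : finGroupType) g (A B : 'I_g -> gT) : gT :=
  (\prod_(i < g) (A i * B i * (A i)^-1 * (B i)^-1))%g.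

(** Moving [u] past [b] releases [c], and moving [c] past [a] turns it into [e]: a u b u^-1 a^-1 = a
    c b a^-1 = e a b a^-1. *)
Lemma commutator_modify (gT : finGroupType) (a b u c e y : gT) :
  (u * b = c * b * u)%g -> (a * c = e * a)%g ->
  (e * (a * b * a^-1 * b^-1 * y) = 1)%g ->
  ((a * u) * b * (a * u)^-1 * b^-1 * y = 1)%g.
Proof.
move=> ub ac <-; rewrite invMg -(mulgA a) ub !mulgA ac.
by rewrite -!mulgA !mulKVg.
Qed.

(* Extend the matrices by one row on top. The relator becomes a transvection by
   a row z, with z_0 = 0 automatically and z_1 = 0 by the hypothesis on a and b.
   Replacing A_0 by A_0 T_u, where T_u is the transvection by u, multiplies the
   relator by T_e with e A_0 B_0 = u (B_0 - 1). So e = - z requires solving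
   u (B_0 - 1) = - z A_0 B_0, which is a shift of coordinates since B_0 - 1 is the
   nilpotent Jordan block. *)
Lemma closed_surface_ladders g (a b : 'I_g.+1 -> L) :
  b ord0 = 1 -> \sum_i (a i ^+ p * b i - b i ^+ p * a i) = 0 ->
  forall m, exists A B : 'I_g.+1 -> GL_finGroup L m,
    [/\ forall i, ladder p (a i) (GL_mx (A i)),
        forall i, ladder p (b i) (GL_mx (B i)),
        commutator_prod A B = 1%g & GL_mx (B ord0) = ladder_mx p m 1].
Proof.
move=> b0 omega0; have pr_p := pcharf_prime pcharL.
elim=> [|m [A [B [lA lB AB1 B0]]]].
  exists (fun=> 1%g), (fun=> 1%g).
  have l1 c : ladder p c (GL_mx (1%g : GL_finGroup L 0)).
    move=> i j; rewrite !ord1 GL_mx1; split=> //; by rewrite mxE.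
  split=> //; first by rewrite /commutator_prod big1 // => i _; rewrite !invg1 !mulg1.
  by rewrite GL_mx1; apply/matrixP => i j; rewrite !ord1 !mxE eqxx.
pose A' i := GL_ext (first_row m (a i ^+ (p ^ m))) (A i).
pose B' i := GL_ext (first_row m (b i ^+ (p ^ m))) (B i).
have lA' i : ladder p (a i) (GL_mx (A' i)) by apply: ladder_ext_first_row.
have lB' i : ladder p (b i) (GL_mx (B' i)) by apply: ladder_ext_first_row.
have [z Ez] : GL_covers (commutator_prod A' B') (1%g : GL_finGroup L m).
  rewrite -AB1; apply: GL_covers_prod => i.
  have cA : GL_covers (A' i) (A i) by eexists.
  have cB : GL_covers (B' i) (B i) by eexists.
  exact: GL_coversM (GL_coversM (GL_coversM cA cB) (GL_coversV cA)) (GL_coversV cB).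
have lZ : ladder p 0 (GL_mx (commutator_prod A' B')).
  have := @ladder_GL_prod p L pcharL m.+1 _ (index_enum 'I_g.+1) (fun=> 0)
    (fun i => A' i * B' i * (A' i)^-1 * (B' i)^-1)%g.
  by rewrite big1 //; apply => i; exact: (ladder_GL_comm pcharL (lA' i) (lB' i)).
have zE (j : 'I_m.+1) :
    z 0 j = GL_mx (commutator_prod A' B') ord0 (lift ord0 j).
  by rewrite Ez GL_ext_entry.
(* The first coordinate is a superdiagonal entry with label 0. The second is the corner, a sum of
   values from [corner_comm], hence a Frobenius power of the sum assumed to vanish. *)
have z01 (j : 'I_m.+1) : (j < 2)%N -> z 0 j = 0.
  rewrite zE; case Ej: (j : nat) => [|[|//]] _.
    rewrite (ladder_super lZ) /= ?Ej // subSS subn0 expr0n expn_eq0.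
    by rewrite -leqn0 leqNgt prime_gt0.
  case: m j Ej A B lA lB AB1 B0 A' B' lA' lB' z Ez lZ zE => [|m] j Ej A B lA lB
    AB1 B0 A' B' lA' lB' z Ez lZ zE; first by have := ltn_ord j; rewrite Ej.
  rewrite (_ : lift ord0 j = inord 2); last first.
    by apply: val_inj; rewrite [LHS]lift0 /= inordK ?Ej.
  rewrite (corner_prod pcharL); last first.
    by move=> i; exact: (ladder_GL_comm pcharL (lA' i) (lB' i)).
  under eq_bigr => i _ do rewrite (corner_comm pcharL (lA' i) (lB' i)).
  have sumX (I : Type) (s : seq I) (F : I -> L) :
      \sum_(i <- s) F i ^+ (p ^ m) = (\sum_(i <- s) F i) ^+ (p ^ m).
    elim: s => [|i s IH]; last by rewrite !big_cons IH exprDpX.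
    by rewrite !big_nil expr0n expn_eq0 -leqn0 leqNgt prime_gt0.
  by rewrite sumX omega0 expr0n expn_eq0 -leqn0 leqNgt prime_gt0.
pose w := - (z *m GL_mx (A ord0) *m GL_mx (B ord0)).
have [|u u0 uB] := @solve_shift m w.
  move=> j j2; rewrite mxE.
  rewrite (@row_mul_upper _ 2) ?oppr0 // => [j'|i i']; last exact: ladder_upper (lB _).
  by apply: row_mul_upper => // i i'; exact: ladder_upper (lA _).
pose T v := GL_ext v (1%g : GL_finGroup L m).
pose c := - (z *m GL_mx (A ord0)).
have TB : (T u * B' ord0 = T c * B' ord0 * T u)%g.
  rewrite !GL_extM !mul1g !mulg1 GL_mx1; congr GL_ext.
  by rewrite -[1]/(1%:M) mulmx1 B0 uB /w mulNmx -B0 addrCA addrA.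
have AT : (A' ord0 * T c = T (- z) * A' ord0)%g.
  rewrite !GL_extM !mul1g !mulg1 GL_mx1 -[1]/(1%:M) mulmx1 mulNmx; congr GL_ext.
  exact: addrC.
have Tz : (T (- z) * commutator_prod A' B' = 1)%g.
  by rewrite Ez GL_extM mulg1 GL_mx1 -[1]/(1%:M) mulmx1 subrr GL_ext01.
exists (fun i => if i == ord0 then A' ord0 * T u else A' i)%g, B'; split=> //.
(* As [u] starts with 0, the transvection preserves the label of [A' ord0]. *)
- move=> i; case: eqP => [->|//]; rewrite GL_extM mulg1.
  by apply: ladder_ext => //; rewrite GL_mx1 -[1]/(1%:M) mulmx1 !mxE u0 eqxx add0r.
- move: Tz; rewrite /commutator_prod !big_ord_recl /=.
  exact: commutator_modify TB AT.
(* [B' ord0] is left unmodified and remains the exact Jordan block for the next row. *)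
by rewrite /B' b0 expr1n; exact: ext_ladder_mx1.
Qed.

End ClosedSurface.

(** * Powers of ladders and the norm to the prime field *)

Section LadderPowers.
Variables (p k : nat) (L : finFieldType).
Hypothesis pcharL : p \in [pchar L].
Local Notation m := (p ^ k)%N.
Local Notation M := 'M[L]_m.+1.
Local Notation gL := (GL_finGroup L m).

Let pr_p : prime p. Proof. exact: pcharf_prime pcharL. Qed.

(** Each factor [X - 1] moves strictly to the right; reaching distance [l] in [l] factors forces
    unit steps, which multiply [l] consecutive superdiagonal entries. *)
Lemma ladder_nilpotent a (X : M) : ladder p a X ->
  forall l (i j : 'I_m.+1), ((j < i + l)%N -> ((X - 1) ^+ l) i j = 0) /\
   (j = (i + l)%N :> nat ->
    ((X - 1) ^+ l) i j = a ^+ (\sum_(h < l) p ^ (m - (i + h).+1))%N).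
Proof.
move=> lX; elim=> [|l IH] i j.
  rewrite expr0 mxE addn0; split=> [ji|/val_inj->]; last by rewrite eqxx big_ord0.
  by rewrite -val_eqE /= gtn_eqF.
have T0 (r : 'I_m.+1) : (r <= i)%N -> (X - 1) i r = 0.
  rewrite leq_eqVlt => /orP[/eqP/val_inj->|ri]; rewrite !mxE.
    by rewrite (ladder_diag _ lX) eqxx subrr.
  by rewrite (ladder_upper lX) // -val_eqE /= gtn_eqF // subr0.
rewrite exprS mxE; split=> ji.
  rewrite big1 // => r _; have [/T0->|ir] := leqP r i; first by rewrite mul0r.
  by have [->] := IH r j; rewrite ?mulr0 //; lia.
have i1 : (i.+1 < m.+1)%N by have := ltn_ord j; lia.
rewrite (bigD1 (Ordinal i1)) //= big1 ?addr0 => [|r ri]; last first.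
  have [/T0->|ir] := leqP r i; first by rewrite mul0r.
  have {}ri : r <> i.+1 :> nat by move=> e; case/eqP: ri; apply: val_inj.
  by have [->] := IH r j; rewrite ?mulr0 //; lia.
have [_ ->] := IH (Ordinal i1) j; last by rewrite /= ji; lia.
rewrite !mxE (ladder_super lX) // -val_eqE /= ltn_eqF // subr0 -exprD.
rewrite big_ord_recl /= addn0; congr (_ ^+ (_ + _)).
by apply: eq_bigr => h _; rewrite addnS addSn.
Qed.

Lemma expr1DpX (T : M) l : (1 + T) ^+ (p ^ l) = 1 + T ^+ (p ^ l).
Proof.
have pM : p \in [pchar M].
  rewrite inE pr_p /= -(rmorph_nat (@scalar_mx L m.+1)).
  by rewrite (pcharf0 pcharL) rmorph0.
elim: l => [|l IH]; first by rewrite !expr1.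
rewrite expnSr !exprM IH -!(pFrobenius_autE pM) pFrobenius_autD_comm.
  by rewrite pFrobenius_aut1.
exact: commr_sym (commr1 _).
Qed.

(** This is 1 + p + ... + p^(m-1): raising to it is the norm to the prime field when [L] has p^m
    elements. *)
Definition norm_exponent : nat := (\sum_(h < m) p ^ (m - h.+1))%N.

Local Notation E := (delta_mx ord0 ord_max : M).

(** Since m is a power of p, X^m = 1 + (X - 1)^m, and only the top right entry lies at distance m
    from the diagonal. *)
Lemma ladder_norm a (X : M) : ladder p a X ->
  X ^+ m = 1 + a ^+ norm_exponent *: E.
Proof.
move=> lX; rewrite -{1}[X](subrK 1) addrC expr1DpX; congr (_ + _).
apply/matrixP => i j; rewrite !mxE.
have [z c] := ladder_nilpotent lX m i j.
have [ji|ij] := ltnP j (i + m).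
  rewrite z // (_ : (i == ord0) && _ = false) ?mulr0 //.
  apply/negbTE/negP => /andP[/eqP i0 /eqP jm].
  by move: ji; rewrite i0 jm /= add0n ltnn.
have i0 : i = ord0 by apply: val_inj; have := ltn_ord j => /=; lia.
have jm : j = ord_max by apply: val_inj; have := ltn_ord j => /=; lia.
by rewrite c ?i0 ?jm ?eqxx ?mulr1.
Qed.

(** [p ^ k.+1] is at least the matrix size, so that power of the nilpotent X - 1 vanishes. *)
Lemma ladder_group_p : (p.-group (ladder_groupG pcharL m))%g.
Proof.
suff e : (exponent (ladder_groupG pcharL m) %| p ^ k.+1)%N.
  rewrite -pnat_exponent; apply: pnat_dvd e _.
  by rewrite pnatX pnat_id.
apply/exponentP => x /ladder_groupP[a lx]; apply: GL_mx_inj.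
have GL_mxX l : GL_mx (x ^+ l)%g = GL_mx x ^+ l.
  by elim: l => [|l IH]; rewrite ?GL_mx1 // expgS GL_mxM IH exprS.
rewrite GL_mxX GL_mx1 -{1}[GL_mx x](subrK 1) addrC expr1DpX.
rewrite [_ ^+ _](_ : _ = 0) ?addr0 //; apply/matrixP => i j.
have [-> //] := ladder_nilpotent lx (p ^ k.+1) i j; first by rewrite mxE.
apply: leq_trans (ltn_ord j) (leq_trans _ (leq_addl _ _)).
by rewrite ltn_exp2l // prime_gt1.
Qed.

(** The p multiples of 1 already exhaust the roots of 'X^p - 'X. *)
Lemma prime_field_elt (c : L) : c ^+ p = c -> exists j, c = j%:R.
Proof.
move=> cp; pose q : {poly L} := 'X^p - 'X.
have sq : size q = p.+1.
  by rewrite size_polyDl size_polyXn // size_polyN size_polyX ltnS prime_gt1.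
pose rs := [seq j%:R : L | j <- iota 0 p].
have [/mapP[j _ ->]|cN] := boolP (c \in rs); first by exists j.
have : (size (c :: rs) < size q)%N.
  apply: max_poly_roots; first by rewrite -size_poly_gt0 sq.
    apply/allP => x; rewrite /root !hornerE inE => /orP[/eqP->|].
      by rewrite cp subrr.
    by move=> /mapP[j _ ->]; rewrite -(pFrobenius_autE pcharL)
      pFrobenius_aut_nat subrr.
  rewrite /= cN map_inj_in_uniq ?iota_uniq // => i j.
  rewrite !mem_iota !add0n /= => ip jp /eqP.
  wlog ij : i j ip jp / (i <= j)%N => [W|].
    by case/orP: (leq_total i j) => [/W|/W W' /eqP e]; [apply|
      apply/esym/W'; rewrite // e].
  rewrite eq_sym -subr_eq0 -natrB // -(dvdn_pcharf pcharL).
  by rewrite /dvdn modn_small; [move/eqP; lia|lia].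
by rewrite sq /= size_map size_iota ltnn.
Qed.

(** For N the norm exponent, the geometric sum gives N p = N - 1 + p^m, and a^(p^m) = a; so
    Frobenius fixes a^N. *)
Lemma norm_prime_field (a : L) : #|L| = (p ^ m)%N ->
  exists j, a ^+ norm_exponent = j%:R.
Proof.
move=> cardL; apply: prime_field_elt.
have m_gt0 : (0 < m)%N by rewrite expn_gt0 prime_gt0.
have [->|a0] := eqVneq a 0.
  suff -> : (0 : L) ^+ norm_exponent = 0 by rewrite expr0n gtn_eqF // prime_gt0.
  rewrite expr0n gtn_eqF // /norm_exponent -(prednK m_gt0) big_ord_recr /=.
  by rewrite subnn expn0 addn1.
rewrite -exprM.
have -> : (norm_exponent * p = norm_exponent.-1 + p ^ m)%N.
  have : (norm_exponent * p.-1 = (p ^ m).-1)%N.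
    rewrite predn_exp mulnC; congr (_ * _)%N.
    by rewrite /norm_exponent (reindex_inj rev_ord_inj); apply: eq_bigr => h _;
      rewrite /= subnSK // subKn // ltnW.
  have := prime_gt0 pr_p; have : (0 < p ^ m)%N by rewrite expn_gt0 prime_gt0.
  have : (0 < norm_exponent)%N.
    by rewrite /norm_exponent -(prednK m_gt0) big_ord_recr /= subnn expn0 addn1.
  move: norm_exponent (p ^ m)%N; clear; move=> s q; nia.
have aL : a ^+ (p ^ m) = a by rewrite -cardL expf_card.
rewrite exprD aL -exprSr prednK //.
rewrite /norm_exponent -(prednK m_gt0) big_ord_recr /=.
by rewrite subnn expn0 addn1.
Qed.

Hypothesis k_gt0 : (0 < k)%N.

(** As k > 0, the top right corner lies beyond the first superdiagonal. *)
Fact top_elt_ladder : ladder p 0 (1 + E : M).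
Proof.
move=> i j; rewrite !mxE.
have m_gt1 : (1 < m)%N by rewrite -(expn0 p) ltn_exp2l // prime_gt1.
split=> [ji|->|ji].
- rewrite -!val_eqE /= gtn_eqF // add0r (_ : _ && _ = false) //.
  by apply/negbTE/negP => /andP[/eqP i0]; rewrite i0 ltn0 in ji.
- rewrite eqxx -!val_eqE /= (_ : _ && _ = false) ?addr0 //.
  by apply/negbTE/negP => /andP[/eqP -> /eqP m0]; rewrite -m0 in m_gt1.
rewrite -!val_eqE /= ji ltn_eqF // add0r expr0n expn_eq0.
rewrite (gtn_eqF (prime_gt0 pr_p)) /=; case: eqP => //= i0.
by rewrite i0 ltn_eqF.
Qed.

Fact top_elt_unit : (1 + E : M) \is a GRing.unit.
Proof. exact: ladder_unit top_elt_ladder. Qed.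

Definition top_elt : gL := FinRing.Unit top_elt_unit.

Lemma top_elt_exp j : GL_mx (top_elt ^+ j)%g = 1 + j%:R *: E.
Proof.
have m_gt0 : (0 < m)%N by rewrite expn_gt0 prime_gt0.
have E2 : E *m E = 0.
  by rewrite mul_delta_mx_0 // -val_eqE /= gtn_eqF.
elim: j => [|j IH]; first by rewrite GL_mx1 scale0r addr0.
rewrite expgS GL_mxM IH -[GL_mx top_elt]/(1 + E).
rewrite mulrDl mul1r mulrDr mulr1 -scalerAr [E * E]E2 scaler0 addr0.
by rewrite mulrS scalerDl scale1r -addrA; congr (_ + _); rewrite addrC.
Qed.

Lemma top_elt_central a (x : gL) : ladder p a (GL_mx x) -> commute top_elt x.
Proof.
move=> lx; apply: GL_mx_inj; rewrite !GL_mxM -[GL_mx top_elt]/(1 + E).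
rewrite mulrDl mulrDr mul1r mulr1; congr (_ + _).
have e1 i : GL_mx x i ord0 = (i == ord0)%:R.
  have [->|i0] := eqVneq i ord0; first exact: ladder_diag lx.
  by rewrite (ladder_upper lx) // lt0n.
have e2 j : GL_mx x ord_max j = (j == ord_max)%:R.
  have [->|j0] := eqVneq j ord_max; first exact: ladder_diag lx.
  rewrite (ladder_upper lx) // ltn_neqAle -ltnS ltn_ord andbT.
  by apply: contraNneq j0 => e; apply/eqP/val_inj.
apply/matrixP => i j; rewrite !mxE.
rewrite (bigD1 ord_max) // big1 /= => [|l lm]; last first.
  by rewrite !mxE (negPf lm) andbF mul0r.
rewrite [RHS](bigD1 ord0) // [X in _ = _ + X]big1 /= => [|l lm]; last first.
  by rewrite !mxE (negPf lm) mulr0.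
rewrite !addr0 !mxE e1 e2 !eqxx -!natrM.
by case: (i == ord0); case: (j == ord_max).
Qed.

End LadderPowers.

Lemma index_enumE (T : finType) : index_enum T = enum T.
Proof. by rewrite /index_enum unlock enumT. Qed.

(** * From independent labels to a detecting quotient *)

Section WordValues.
Variables (g n : nat) (gT : finGroupType) (f : surface_gen g n -> gT).

Lemma word_val_relator :
  word_val f (surface_relator g n) =
  (commutator_prod (fun i => f (inl (i, false))) (fun i => f (inl (i, true))) *
   \prod_(j < n) f (inr j))%g.
Proof.
rewrite word_val_cat; congr (_ * _)%g.
  transitivity (\prod_(i <- enum 'I_g) (f (inl (i, false)) * f (inl (i, true)) *
      (f (inl (i, false)))^-1 * (f (inl (i, true)))^-1))%g.
    elim: (enum _) => [|i s IH]; first by rewrite big_nil.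
    rewrite big_cons -IH -cat1s map_cat flatten_cat word_val_cat.
    by congr (_ * _)%g; rewrite /word_val /letter_val /= mulg1 !mulgA.
  by rewrite /commutator_prod index_enumE.
transitivity (\prod_(j <- enum 'I_n) f (inr j))%g; last by rewrite index_enumE.
elim: (enum _) => [|i s IH]; first by rewrite big_nil.
by rewrite big_cons -IH.
Qed.

End WordValues.

Section Detection.
Variables (p k : nat) (L : finFieldType).
Hypotheses (pcharL : p \in [pchar L]) (k_gt0 : (0 < k)%N).
Hypothesis cardL : #|L| = (p ^ (p ^ k))%N.
Variables (g n : nat) (alpha : surface_gen g n -> L).
Variable f : surface_gen g n -> GL_finGroup L (p ^ k)%N.
Hypothesis ladder_f : forall s, ladder p (alpha s) (GL_mx (f s)).
Hypothesis f_relator : word_val f (surface_relator g n) = 1%g.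
Hypothesis alpha_indep : forall c : surface_gen g n -> int,
  \sum_ib alpha (inl ib) *~ c (inl ib) +
    \sum_j alpha (inr j) *~ c (inr j) = 0 ->
  (forall ib, (p %| c (inl ib))%Z) /\
  (forall j j', (p %| c (inr j) - c (inr j'))%Z).

(** The power m of [phi x] is [top_elt] to the norm of the label of [x]. If it is trivial the label
    is 0, and [alpha_indep] makes [x] trivial modulo p. *)
Lemma ladder_detected : detected g n p.
Proof.
have pr_p := pcharf_prime pcharL.
have [phi phiM phiE] : exists2 phi : surface_group g n -> GL_finGroup L (p ^ k),
    {morph phi : x y / (x * y)%g} &
    forall w, phi (word_class [:: surface_relator g n] w) = word_val f w.
  by apply: presented_hom => r; rewrite inE => /eqP->.
have lad x : exists a, ladder p a (GL_mx (phi x)).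
  have [w ->] := word_class_surj x; rewrite phiE.
  elim: w => [|[s b] w [a la]]; first by exists 0; rewrite GL_mx1; apply: ladder1.
  have [b' lb] : exists b', ladder p b' (GL_mx (letter_val f (s, b))).
    rewrite /letter_val; case: b; last by exists (alpha s).
    by exists (- alpha s); apply: ladder_GL_V.
  by exists (b' + a); apply: ladder_GL_M.
(* Inside the ladder group the order is a power of p and [top_elt] is central. *)
pose U := ladder_groupG pcharL (p ^ k).
have inU x : phi x \in U by apply/ladder_groupP.
have z0U : top_elt pcharL k_gt0 \in U.
  by apply/ladder_groupP; exists 0; exact: top_elt_ladder.
pose z0 : subg_of U := subg U (top_elt pcharL k_gt0).
pose psi x : subg_of U := subg U (phi x).
have cardU : #|subg_of U| = (p ^ logn p #|U|)%N.
  by rewrite -(card_pgroup (ladder_group_p k pcharL)) card_sub.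
have valX (x : subg_of U) i : val (x ^+ i)%g = (val x ^+ i)%g.
  by elim: i => // i IH; rewrite !expgS -IH.
(* The last superdiagonal entry has Frobenius exponent 1, so it is the label itself. *)
pose chi x := GL_mx (phi x) (inord (p ^ k).-1) ord_max.
have m_gt0 : (0 < p ^ k)%N by rewrite expn_gt0 prime_gt0.
have chiE a x : ladder p a (GL_mx (phi x)) -> chi x = a.
  move=> la; rewrite /chi (ladder_super la) /= ?subnn ?expn0 ?expr1 //.
  by rewrite inordK ?prednK // ltnS leq_pred.
have chiM x y : chi (x * y)%g = chi x + chi y.
  have [a la] := lad x; have [b lb] := lad y.
  rewrite (chiE _ _ la) (chiE _ _ lb); apply: chiE.
  by rewrite phiM; exact: ladder_GL_M.
have chi_gen s : chi (word_class _ [:: (s, false)]) = alpha s.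
  by apply: chiE; rewrite phiE -[word_val f _]/(f s * 1)%g mulg1; exact: ladder_f.
have normE x : exists2 j, (phi x ^+ (p ^ k))%g = (top_elt pcharL k_gt0 ^+ j)%g &
    (phi x ^+ (p ^ k) = 1)%g -> chi x = 0.
  have [a la] := lad x; have [j ja] := norm_prime_field pcharL a cardL.
  have GL_mxX l : GL_mx (phi x ^+ l)%g = GL_mx (phi x) ^+ l.
    by elim: l => [|l IH]; rewrite ?GL_mx1 // expgS GL_mxM IH exprS.
  exists j.
    by apply: GL_mx_inj; rewrite GL_mxX top_elt_exp (ladder_norm pcharL la) ja.
  move=> /(congr1 (fun y => GL_mx y ord0 ord_max)).
  rewrite GL_mxX (ladder_norm pcharL la) GL_mx1 !mxE !eqxx mulr1.
  move/(canRL (addKr _)); rewrite addNr (chiE _ _ la) => /eqP.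
  by rewrite expf_eq0 => /andP[_ /eqP].
exists (subg_of U), psi, z0, (p ^ k)%N, (k + logn p #|U|)%N; split.
- by move=> x y; rewrite /psi phiM subgM.
- move=> y; apply: val_inj; rewrite /= subgK //.
  by have /ladder_groupP[a la] := subgP y; exact: top_elt_central la.
- by rewrite cardU dvdn_exp2l ?leq_addl.
- by rewrite dvdn_exp2l ?leq_addr.
move=> x; have [j ej chi0] := normE x; exists j.
  by apply: val_inj; rewrite !valX !subgK.
move=> nt; apply/eqP => /(congr1 val); rewrite valX subgK // => /chi0.
rewrite -[x]reprK -/(word_class _ _) character_exponent //.
under eq_bigr do rewrite chi_gen.
under [X in _ + X = _]eq_bigr do rewrite chi_gen.
exact: (contra_not (alpha_indep (c := fun s => gen_exponent s (repr x))) nt).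
Qed.

End Detection.

(** * Generic elements of large finite fields *)

Section GenericElement.
Variables (p : nat).
Hypothesis pr_p : prime p.

Lemma intr_pchar (L : fieldType) (c : int) : p \in [pchar L] ->
  c%:~R = `|(c %% p)%Z|%N%:R :> L.
Proof.
move=> pL; rewrite {1}(divz_eq c p) rmorphD rmorphM /= -[p%:~R]/(p%:R).
rewrite (pcharf0 pL) mulr0 add0r -{1}(gez0_abs (modz_ge0 c _)) //.
by have := prime_gt0 pr_p; lia.
Qed.

(** [r] avoids the roots of [Q], the product of all nonzero polynomials of degree below B over the
    prime field. *)
Lemma generic_element B : exists (k : nat) (L : finFieldType) (r : L),
  [/\ (0 < k)%N, p \in [pchar L], #|L| = (p ^ (p ^ k))%N &
      forall c : nat -> int, \sum_(i < B) r ^+ i *~ c i = 0 ->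
        forall i, (i < B)%N -> (p %| c i)%Z].
Proof.
have p_gt1 := prime_gt1 pr_p; have p_gt0 := prime_gt0 pr_p.
(* This bounds the size of [Q], so a field with p^(p^k) elements has a non-root. *)
pose k := (p ^ B * B).+1.
have pk_gt0 : (0 < p ^ k)%N by rewrite expn_gt0 p_gt0.
have [L pL cardL] := pPrimePowerField pr_p pk_gt0.
pose P (F : {ffun 'I_B -> 'I_p}) : {poly L} :=
  \poly_(i < B) (if insub i is Some j then (F j : nat)%:R else 0).
have PE F (j : 'I_B) : (P F)`_j = (F j : nat)%:R.
  by rewrite coef_poly ltn_ord insubT //= => lt; congr (F _)%:R; apply: val_inj.
have P_neq0 (F : {ffun 'I_B -> 'I_p}) (j : 'I_B) : (F j : nat) != 0%N -> P F != 0.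
  apply: contraNneq => P0; have := PE F j; rewrite P0 coef0 => /esym/eqP.
  by rewrite -(dvdn_pcharf pL) /dvdn modn_small.
pose Q := \prod_(F : {ffun 'I_B -> 'I_p} | P F != 0) P F.
have Q_neq0 : Q != 0 by apply/prodf_neq0.
have sizeQ : (size Q <= (p ^ B * B).+1)%N.
  apply: leq_trans (size_poly_prod_leq _ _) _.
  apply: leq_trans (leq_subr _ _) _; rewrite ltnS.
  apply: (@leq_trans (\sum_(F : {ffun 'I_B -> 'I_p}) B)).
    rewrite big_mkcond leq_sum // => F _; case: ifP => // _.
    exact: size_poly.
  by rewrite sum_nat_const card_ffun !card_ord.
have [r Qr] : exists r, ~~ root Q r.
  apply: contrapT => noroot.
  have : (size (enum L) < size Q)%N.
    apply: max_poly_roots => //; last exact: enum_uniq.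
    apply/allP => x _; apply: contraT => nx; case: noroot; by exists x.
  rewrite -cardE cardL => /leq_trans/(_ sizeQ); rewrite ltnNge => /negP; apply.
  apply: leq_trans (ltnW (ltn_expl (p ^ k) p_gt1)).
  exact: ltnW (ltn_expl k p_gt1).
exists k, L, r; split=> // c sum0 i iB.
have modp j : (`|(c j %% p)%Z|%N < p)%N.
  by rewrite -ltz_nat gez0_abs ?modz_ge0 ?ltz_pmod //; lia.
pose F := [ffun j : 'I_B => Ordinal (modp j)].
have PFr : (P F).[r] = 0.
  rewrite horner_poly -[RHS]sum0; apply: eq_bigr => j _.
  have := PE F j; rewrite coef_poly ltn_ord => ->.
  by rewrite ffunE /= -(intr_pchar _ pL) mulrC mulrzr.
have PF0 : P F = 0.
  apply/eqP; apply: contraNT Qr => nz.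
  by rewrite /root /Q (bigD1 F) //= hornerM PFr mul0r.
have : (F (Ordinal iB) : nat) == 0%N.
  by apply: contraTT isT => /P_neq0; rewrite PF0 eqxx.
by rewrite ffunE /= absz_eq0 => /eqP/dvdz_mod0P.
Qed.

(** Monomials with equal exponents cannot be separated, so only sums of their coefficients are
    controlled. *)
Lemma generic_monomials (T : finType) (e : T -> nat) :
  exists (k : nat) (L : finFieldType) (r : L),
  [/\ (0 < k)%N, p \in [pchar L], #|L| = (p ^ (p ^ k))%N, r != 0 &
      forall c : T -> int, \sum_t r ^+ e t *~ c t = 0 ->
        forall t0, (p %| (\sum_(t | e t == e t0) c t)%R)%Z].
Proof.
(* B exceeds every [e t] and is at least 2; degree 1 is thus included, which excludes r = 0. *)
pose B := (\max_t e t).+2.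
have [k [L [r [k_gt0 pL cardL ind]]]] := generic_element B.
have eB t : (e t < B)%N by rewrite /B ltnS ltnW // ltnS leq_bigmax.
exists k, L, r; split=> // [|c sum0 t0].
  apply/eqP => r0; have := ind (fun i => (i == 1)%N%:Z).
  rewrite (bigD1 (Ordinal (isT : (1 < B)%N))) //= r0 expr1 mul0rz add0r.
  rewrite big1 => [|i]; last first.
    by rewrite -val_eqE /= => /negPf->; rewrite mulr0z.
  move=> /(_ erefl 1%N isT) p1; have {p1} : (p %| 1)%N by exact: p1.
  by rewrite dvdn1 => /eqP p1; move: pr_p; rewrite p1.
apply: (ind (fun i => \sum_(t | e t == i) c t) _ (e t0)) => //.
rewrite -[RHS]sum0 (partition_big (fun t => Ordinal (eB t)) xpredT) //=.
apply: eq_bigr => i _; rewrite mulrz_sumr; apply: eq_big => [t|t /eqP->] //.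
Qed.

End GenericElement.

(** * Choice of labels for punctured and closed surfaces *)

Section LadderElement.
Variables (p : nat) (L : finFieldType) (m : nat).
Hypothesis pcharL : p \in [pchar L].

Definition ladder_elt (a : L) : GL_finGroup L m :=
  FinRing.Unit (ladder_unit (@ladder_mxP p L m a)).

Lemma ladder_eltP a : ladder p a (GL_mx (ladder_elt a)).
Proof. exact: ladder_mxP. Qed.

End LadderElement.

(** The relator is solved for the first puncture loop. The other generators are free and get
    distinct powers of [r] as labels. *)
Lemma detected_punctured p g n : prime p -> detected g n.+1 p.
Proof.
move=> pr_p.
pose T : finType := ('I_g * bool + 'I_n)%type.
have [k [L [r [k_gt0 pL cardL _ ind]]]] :=
  generic_monomials pr_p (fun t : T => enum_rank t : nat).
pose x (t : T) := r ^+ (enum_rank t : nat).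
pose alpha (s : surface_gen g n.+1) : L := match s with
  | inl ib => x (inl ib)
  | inr j => if unlift ord0 j is Some j' then x (inr j') else - \sum_j' x (inr j')
  end.
pose h t := ladder_elt p (p ^ k) (x t).
pose C := commutator_prod (fun i => h (inl (i, false))) (fun i => h (inl (i, true))).
pose f (s : surface_gen g n.+1) := match s with
  | inl ib => h (inl ib)
  | inr j => if unlift ord0 j is Some j' then h (inr j')
             else (C^-1 * (\prod_j' h (inr j'))^-1)%g
  end.
have lh t : ladder p (x t) (GL_mx (h t)) by apply: ladder_eltP.
apply: (@ladder_detected p k L pL k_gt0 cardL g n.+1 alpha f).
- case=> [ib|j] /=; first exact: lh.
  case: unliftP => [j' _|_]; first exact: lh.
  have lC : ladder p 0 (GL_mx C).
    have := @ladder_GL_prod p L pL (p ^ k) _ (index_enum 'I_g) (fun=> 0)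
      (fun i => h (inl (i, false)) * h (inl (i, true)) *
                (h (inl (i, false)))^-1 * (h (inl (i, true)))^-1)%g.
    rewrite big1 //; apply => i.
    exact: (ladder_GL_comm pL (lh (inl (i, false))) (lh (inl (i, true)))).
  have lQ := @ladder_GL_prod p L pL _ _ (index_enum 'I_n) (fun j => x (inr j))
    (fun j => h (inr j)) (fun j => lh (inr j)).
  have := ladder_GL_M pL (ladder_GL_V pL lC) (ladder_GL_V pL lQ).
  by rewrite oppr0 add0r.
- rewrite word_val_relator big_ord_recl.
  have -> : (\prod_(i < n) f (inr (lift ord0 i)) = \prod_i h (inr i))%g.
    by apply: eq_bigr => i _; rewrite /f liftK.
  by rewrite {3}/f unlift_none -!mulgA mulVg mulg1 mulgV.
move=> c; rewrite big_ord_recl.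
have -> : \sum_(i < n) alpha (inr (lift ord0 i)) *~ c (inr (lift ord0 i)) =
    \sum_i x (inr i) *~ c (inr (lift ord0 i)).
  by apply: eq_bigr => i _; rewrite /alpha liftK.
rewrite {2}/alpha unlift_none.
pose c' (t : T) := match t with
  | inl ib => c (inl ib) | inr j => c (inr (lift ord0 j)) - c (inr ord0) end.
move=> sum0; have {}sum0 : \sum_t x t *~ c' t = 0.
  rewrite -[RHS]sum0 big_sumType /=; congr (_ + _).
  under eq_bigr do rewrite mulrzBr.
  by rewrite big_split /= sumrN -mulrz_suml mulNrz addrC.
have cP t : (p %| c' t)%Z.
  have := ind _ sum0 t; rewrite (big_pred1 t) // => t' /=.
  by rewrite (inj_eq val_inj) (inj_eq enum_rank_inj).
split=> [ib|j j']; first exact: (cP (inl ib)).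
have D i : (p %| c (inr i) - c (inr ord0))%Z.
  case: (unliftP ord0 i) => [i' ->|->]; first exact: (cP (inr i')).
  by rewrite subrr dvdz0.
rewrite (_ : c (inr j) - c (inr j') =
  c (inr j) - c (inr ord0) - (c (inr j') - c (inr ord0))); last by ring.
by rewrite rpredB.
Qed.

Lemma sum_pair (V : nmodType) (I J : finType) (F : I * J -> V) :
  \sum_q F q = \sum_i \sum_j F (i, j).
Proof. by rewrite pair_bigA; apply: eq_bigr => -[]. Qed.

Lemma sum_unit (V : nmodType) (I : finType) (F : unit + I -> V) :
  \sum_q F q = F (inl tt) + \sum_i F (inr i).
Proof.
by rewrite big_sumType (big_pred1 tt) // => -[].
Qed.

(* With a = u^(-p) and b = u^(1+p+p^2) one has a^p b - b^p a = w - w^(p^2), where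
   w = u^(1+p); this telescopes against y = w + w^p. *)
Lemma artin_schreier_pair (p : nat) (L : fieldType) (u : L) :
  p \in [pchar L] -> u != 0 ->
  let y := u ^+ p.+1 + u ^+ (p * p.+1) in
  let a := (u ^+ p)^-1 in let b := u ^+ (p * p + p.+1) in
  y ^+ p - y + (a ^+ p * b - b ^+ p * a) = 0.
Proof.
move=> pL u0 /=; rewrite -[X in X - _](pFrobenius_autE pL) pFrobenius_autD_comm.
  rewrite !(pFrobenius_autE pL) -!exprM.
  have -> : (u ^+ p)^-1 ^+ p * u ^+ (p * p + p.+1) = u ^+ p.+1.
    by rewrite exprVn -exprM exprD mulKf // expf_neq0.
  have -> : u ^+ ((p * p + p.+1) * p) / u ^+ p = u ^+ (p * p.+1 * p).
    rewrite (_ : (p * p + p.+1) * p = p * p.+1 * p + p)%N; last by lia.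
    by rewrite exprD mulfK // expf_neq0.
  by rewrite (mulnC p.+1); ring.
exact: mulrC.
Qed.

(** Handle 0 has labels sum y_j and 1, handle j + 1 has u_j^(-p) and u_j^S. By [artin_schreier_pair]
    the contribution of handle j + 1 cancels y_j^p - y_j. *)
Lemma detected_closed p g : prime p -> detected g.+2 0 p.
Proof.
move=> pr_p; have p_gt1 := prime_gt1 pr_p.
(* The factors u_j = r^(M j) with M j = 1 mod S make the exponents separable:
   only those of b_j are multiples of S (after removing the offset p * M g, which
   clears the negative powers). *)
pose S := (p * p + p.+1)%N.
pose M (j : nat) := (S * j).+1.
pose T : finType := (unit + 'I_g.+1 * (bool * bool))%type.
(* The exponents of [r] after the offset: first the label 1, then the two terms of each y_j, then
   the labels of handle j + 1. *)
pose e (t : T) : nat := match t with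
  | inl tt => p * M g
  | inr (j, (false, false)) => p * M g + p.+1 * M j
  | inr (j, (false, true)) => p * M g + p * p.+1 * M j
  | inr (j, (true, false)) => p * (M g - M j)
  | inr (j, (true, true)) => p * M g + S * M j
  end%N.
have [k [L [r [k_gt0 pL cardL r0 ind]]]] := generic_monomials pr_p e.
pose u (j : 'I_g.+1) := r ^+ M j.
have u0 j : u j != 0 by rewrite expf_neq0.
pose y (j : 'I_g.+1) := u j ^+ p.+1 + u j ^+ (p * p.+1).
pose a (i : 'I_g.+2) :=
  if unlift ord0 i is Some j then (u j ^+ p)^-1 else \sum_j y j.
pose b (i : 'I_g.+2) := if unlift ord0 i is Some j then u j ^+ S else 1.
have b0 : b ord0 = 1 by rewrite /b unlift_none.
have omega0 : \sum_i (a i ^+ p * b i - b i ^+ p * a i) = 0.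
  rewrite big_ord_recl b0.
  have -> : \sum_(i < g.+1) (a (lift ord0 i) ^+ p * b (lift ord0 i) -
      b (lift ord0 i) ^+ p * a (lift ord0 i)) =
    \sum_j ((u j ^+ p)^-1 ^+ p * u j ^+ S - (u j ^+ S) ^+ p * (u j ^+ p)^-1).
    by apply: eq_bigr => i _; rewrite /a /b liftK.
  rewrite /a unlift_none mulr1 expr1n mul1r -(pFrobenius_autE pL) raddf_sum.
  rewrite -sumrB -big_split.
  rewrite big1 // => j _ /=; rewrite (pFrobenius_autE pL).
  exact: artin_schreier_pair.
have [A [B [lA lB AB1 _]]] := closed_surface_ladders pL b0 omega0 (p ^ k).
pose alpha (s : surface_gen g.+2 0) : L :=
  if s is inl (i, t) then if t then b i else a i else 0.
pose f (s : surface_gen g.+2 0) : GL_finGroup L (p ^ k) :=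
  if s is inl (i, t) then if t then B i else A i else 1%g.
apply: (@ladder_detected p k L pL k_gt0 cardL g.+2 0 alpha f).
- by case=> [[i []]|[]] /=.
- by rewrite word_val_relator big_ord0 mulg1.
move=> c; rewrite big_ord0 addr0 => sum0.
pose c' (t : T) := match t with
  | inl tt => c (inl (ord0, true))
  | inr (j, (false, _)) => c (inl (ord0, false))
  | inr (j, (true, s)) => c (inl (lift ord0 j, s))
  end.
have Mle (j : 'I_g.+1) : (M j <= M g)%N.
  by rewrite /M ltnS leq_mul2l; have := ltn_ord j; lia.
have {}sum0 : \sum_t r ^+ e t *~ c' t = 0.
  transitivity (r ^+ (p * M g) * \sum_ib alpha (inl ib) *~ c (inl ib)); last first.
    by rewrite sum0 mulr0.
  rewrite mulr_sumr.
  rewrite [RHS]sum_pair [RHS]big_ord_recl big_bool [LHS]sum_unit /=.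
  rewrite b0 mulrzAr mulr1 -[RHS]addrA; congr (_ + _).
  rewrite sum_pair /= {1}/a unlift_none mulrzAr mulr_sumr mulrz_suml -big_split.
  apply: eq_bigr => j _.
  rewrite sum_pair !big_bool /= /a /b liftK.
  have E1 : r ^+ (p * M g) * (u j ^+ p)^-1 = r ^+ (p * (M g - M j)).
    rewrite mulnBr expfB_cond; last by rewrite (negPf r0) add0n leq_mul.
    by rewrite /u -exprM [(M j * p)%N]mulnC.
  have E2 q : r ^+ (p * M g) * u j ^+ q = r ^+ (p * M g + q * M j).
    by rewrite /u -exprM [(M j * q)%N]mulnC exprD.
  rewrite !mulrzAr E1 E2 /y mulrDr !E2 mulrzDl; ring.
have cP t : (forall t', e t' = e t -> t' = t) -> (p %| c' t)%Z.
  move=> inj_t; have := ind _ sum0 t; rewrite (big_pred1 t) // => t' /=.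
  by apply/eqP/eqP => [/inj_t|->].
have c01 : (p %| c (inl (ord0, true)))%Z.
  apply: (cP (inl tt)) => -[[]|[j [[] []]]] //=; have := Mle j; rewrite /M; nia.
(* All terms of the y_j share one coefficient, so it suffices to isolate the term with j = 0, whose
   excess p + 1 over the offset is the least positive one. *)
have c00 : (p %| c (inl (ord0, false)))%Z.
  apply: (cP (inr (ord0, (false, false)))) => -[[]|[j [[] []]]] /=.
  - by rewrite /M /S; nia.
  - by rewrite /M /S; nia.
  - have := Mle j; rewrite /M /S; nia.
  - by rewrite /M /S; nia.
  - rewrite /M => ej; congr (inr (_, _)); apply: val_inj => /=.
    rewrite /S in ej *; nia.
(* M i is 1 modulo S, so q M i is congruent to q, which is nonzero modulo S. *)
have no_multiple q i l : (0 < q < S)%N -> (q * M i = S * l)%N -> False.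
  move=> /andP[q_gt0 qS] eq_l; have : (S %| q * M i)%N by rewrite eq_l dvdn_mulr.
  rewrite /M mulnS mulnCA addnC dvdn_addr ?dvdn_mulr // => /(dvdn_leq q_gt0).
  by rewrite leqNgt qS.
have M_inj (i j : 'I_g.+1) : M i = M j -> i = j.
  by move=> [/eqP]; rewrite eqn_pmul2l ?addn_gt0 ?orbT // => /eqP/val_inj.
have M_gt0 i : (0 < M i)%N by [].
have lt_y (j : 'I_g.+1) : (p * (M g - M j) < p * M g)%N.
  by rewrite ltn_pmul2l ?prime_gt0 // ltn_subrL.
have add_neq x z : (0 < z)%N -> x = (x + z)%N -> False by lia.
have lt_neq x z w : (x < w)%N -> x = (w + z)%N -> False by lia.
have c1 j s : (p %| c (inl (lift ord0 j, s)))%Z.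
  have w_gt0 : (0 < S * M j)%N by rewrite muln_gt0 /S addnS.
  case: s.
    apply: (cP (inr (j, (true, true)))) => -[[]|[j' [[] []]]] /=.
    - by move/add_neq => /(_ w_gt0).
    - move=> /addnI/eqP; rewrite eqn_pmul2l ?addn_gt0 ?orbT // => /eqP.
      by move=> /M_inj ->.
    - by move/lt_neq => /(_ (lt_y j')).
    - by move=> /addnI/no_multiple[]; rewrite /S; nia.
    - by move=> /addnI/no_multiple[]; rewrite /S; nia.
  apply: (cP (inr (j, (true, false)))) => -[[]|[j' [[] []]]] /=.
  - by move=> e1; have := lt_y j; rewrite -e1 ltnn.
  - by move/esym/lt_neq => /(_ (lt_y j)).
  - move=> /eqP; rewrite eqn_pmul2l ?prime_gt0 // => /eqP eM.
    have -> // : j' = j; apply: M_inj.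
    by rewrite -(subKn (Mle j')) eM subKn.
  - by move/esym/lt_neq => /(_ (lt_y j)).
  - by move/esym/lt_neq => /(_ (lt_y j)).
split=> [[i s]|[]//].
by case: (unliftP ord0 i) => [j ->|->]; [exact: c1|case: s].
Qed.

Theorem proposition4 (g n : nat) (d : int)
    (g_ge2 : (2 <= g)%N) (d_sqfree : squarefree d) :
  exists (R : groupClosed (surface_group g n)) (N k : nat),
    [/\ normal_subgroup R,
        has_index R N,
        (N%:Z %| d ^+ k)%Z
      & prim_homology d R <> [set: H1 (subgroup R) rat]].
Proof.
apply: detected_proper => // p pr_p.
case: n => [|n]; last exact: detected_punctured.
by case: g g_ge2 => [|[|g]] // _; exact: detected_closed.
Qed.
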